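(* Let $G$ be a graph and let $\mathcal{U} = \{U_1, \ldots, U_m\}$ be a partition of $V(G)$. Suppose that (a) $(G, \mathcal{U})$ is minimally RGD, (b) $G$ is a disjoint union of complete bipartite graphs, and (c) $G$ has exactly $|\mathcal{U}|$ connected components. Then for every $U_i \in \mathcal{U}$, there exists a complete bipartite component $K_{A,B}$ of $G$ (with parts $A,B$) such that $A \subseteq U_i$.
   Context: For a graph $G$ and a partition $\mathcal{U}$ of $V(G)$, an independent transversal (IT) of $(G,\mathcal{U})$ is an independent set of $G$ containing exactly one vertex from each block. The reconfiguration graph $\mathbf{RG}(G,\mathcal{U})$ has the IT's as vertices, two IT's $S,T$ being adjacent if $S\cup T$ is an independent set of size $|\mathcal{U}|+1$. When $G,\mathcal{U}$ are empty, $\mathbf{RG}$ is a single vertex. $G-U$ is $G$ with the vertices of $U$ deleted. $(G,\mathcal{U})$ is minimally RGD if $\mathbf{RG}(G,\mathcal{U})$ is nonempty and disconnected, but $\mathbf{RG}(G-U_i,\mathcal{U}-\{U_i\})$ is connected for all $U_i\in\mathcal{U}$. *)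

(* Defs.v *)
From mathcomp Require Import all_boot.

Set Implicit Arguments.
Unset Strict Implicit.
Unset Printing Implicit Defensive.

(* The vertex set is a subset of the ambient type, so that vertices can be
   deleted without changing types; edges are those of [adj]. *)
Record graph (T : finType) := Graph { vset : {set T}; adj : rel T }.

Definition simple_graph (T : finType) (G : graph T) : Prop :=
  [/\ symmetric (adj G), irreflexive (adj G)
    & forall x y, adj G x y -> x \in vset G /\ y \in vset G].

Definition induced (T : finType) (G : graph T) (W : {set T}) : graph T :=
  Graph (vset G :&: W) [rel x y | [&& x \in W, y \in W & adj G x y]].

Definition delete (T : finType) (G : graph T) (W : {set T}) : graph T :=
  induced G (~: W).

(* The graph with no vertices is connected for this definition. *)
Definition connected_graph (T : finType) (G : graph T) : bool :=
  [forall x in vset G, forall y in vset G, connect (adj G) x y].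

Definition components (T : finType) (G : graph T) : {set {set T}} :=
  equivalence_partition (connect (adj G)) (vset G).

Definition independent (T : finType) (G : graph T) (S : {set T}) : bool :=
  (S \subset vset G) && [forall x in S, forall y in S, ~~ adj G x y].

Definition indep_transversal (T : finType) (G : graph T) (P : {set {set T}})
    (S : {set T}) : bool :=
  independent G S && [forall U in P, #|S :&: U| == 1].

Definition RG (T : finType) (G : graph T) (P : {set {set T}}) :
    graph {set T} :=
  Graph [set S | indep_transversal G P S]
    [rel S S' | [&& indep_transversal G P S, indep_transversal G P S',
                    independent G (S :|: S') & #|S :|: S'| == #|P|.+1]].

Definition minimally_RGD (T : finType) (G : graph T) (P : {set {set T}}) :
    Prop :=
  [/\ vset (RG G P) != set0, ~~ connected_graph (RG G P)
    & forall U, U \in P -> connected_graph (RG (delete G U) (P :\ U))].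

(* Both parts of a complete bipartite graph are nonempty; with an empty part
   allowed, "A is contained in U" would hold trivially for A empty. *)
Definition complete_bipartite (T : finType) (G : graph T) (A B : {set T}) :
    Prop :=
  [/\ A != set0, B != set0, [disjoint A & B], vset G = A :|: B
    & forall x y, x \in vset G -> y \in vset G ->
        adj G x y = (x \in A) && (y \in B) || (x \in B) && (y \in A)].

Definition union_of_complete_bipartite (T : finType) (G : graph T) : Prop :=
  forall C, C \in components G ->
    exists A B : {set T}, complete_bipartite (induced G C) A B.

(* Main.v *)
Require Import Defs.
From HB Require Import structures.
From mathcomp Require Import all_boot zify.

(* A side of a component is read as a literal on a Boolean variable (the
   component), and a block as the clause of the sides that it meets: an
   independent set lies in the sides chosen by one assignment, so transversals
   correspond to satisfying assignments, and components of RG to components of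
   the set of solutions, where two solutions are linked when the values on which
   they agree already satisfy every clause.  The theorem becomes: if a formula
   with as many clauses as variables has a disconnected set of solutions, but no
   longer so after deleting any clause, then each clause contains a literal that
   occurs nowhere else.

   As in Tarsi's lemma on minimal unsatisfiable formulas, one counts the
   variables of subformulas Q.  If every nonempty Q has at least |Q| (resp.
   |Q| + 1) variables, then the formula is satisfiable (resp. its solutions are
   connected).  Otherwise a maximal Q with few variables splits the formula into
   Q, on its variables D, and the remaining clauses R, restricted to the other
   variables.  Both parts are handled by induction, after merging the literals
   of R on D into a single clause, or replacing D by one new variable shared by
   two clauses of R. *)

Set Implicit Arguments.
Unset Strict Implicit.
Unset Printing Implicit Defensive.

(* Hypotheses about sets slow [lia] down. *)
Ltac nlia :=
  repeat match goal with
  | H : ?T |- _ =>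
    lazymatch T with
    | is_true (leq _ _) => fail
    | is_true _ => clear H
    | @eq _ _ _ => fail
    | _ => clear H
    end
  end; lia.

(** A block may meet both sides of a component, so a clause may contain both literals of a variable.
    Such a clause holds under every assignment, yet a flip of that variable need not keep it
    satisfied; this is why links, and not satisfaction alone, have to be followed.

    The thresholds come from one count. Fixing a variable costs every subformula at most one
    variable, and fixing a literal shared by two clauses disposes of both clauses. If all
    subformulas missing at least two clauses have two more variables than clauses, what remains
    still has one more, hence a connected set of solutions. Only literals owned by a single clause
    escape this count.

    The mere existence of an owned literal does not pass through a splitting: solutions of a part
    are lifted to the whole formula, and the lift stays within one component. The induction
    therefore proves more: both literals of every variable occur, and in each component of the set
    of solutions each clause is, at some solution, satisfied by a literal of its own. *)

Lemma connect_ind (T : finType) (e : rel T) (P : T -> Prop) (x : T) :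
  P x -> (forall y z, connect e x y -> P y -> e y z -> P z) ->
  forall y, connect e x y -> P y.
Proof.
move=> Px step y /connectP[p pth ->] {y}.
elim/last_ind: p pth => [|p z IH] //.
rewrite rcons_path last_rcons => /andP[pth ez].
by apply: step ez; [apply/connectP; exists p | apply: IH].
Qed.

Lemma connect_map (T T' : finType) (e : rel T) (e' : rel T') (f : T -> T')
    (x y : T) :
  (forall y z, e y z -> connect e' (f y) (f z)) ->
  connect e x y -> connect e' (f x) (f y).
Proof.
move=> h; move: y; apply: connect_ind => // y z _ xy yz.
exact: connect_trans xy (h _ _ yz).
Qed.

Lemma max_card_set (I : finType) (p : pred {set I}) :
  (exists Q, p Q) ->
  exists2 Q, p Q & forall Q', p Q' -> #|Q'| <= #|Q|.
Proof.
case=> Q0 pQ0; case: (@arg_maxnP _ Q0 p (fun Q => #|Q|) pQ0) => Q pQ maxQ.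
by exists Q.
Qed.

Lemma setUDK (I : finType) (Q F : {set I}) :
  Q \subset F -> Q :|: (F :\: Q) = F.
Proof. by move=> /setIidPr QF; rewrite -{1}QF setID. Qed.

(* Sealed: comparing distinct instances by unfolding is prohibitively slow. *)
HB.lock Definition satc (I V : finType) (lit : I -> V -> bool -> bool)
    (i : I) (A : {set V}) (s : {ffun V -> bool}) : bool :=
  [exists x in A, lit i x (s x)].
Arguments satc {I V}.

HB.lock Definition sat (I V : finType) (lit : I -> V -> bool -> bool)
    (F : {set I}) (A : {set V}) (s : {ffun V -> bool}) : bool :=
  [forall i in F, satc lit i A s].
Arguments sat {I V}.

HB.lock Definition link (I V : finType) (lit : I -> V -> bool -> bool)
    (F : {set I}) (W : {set V}) (s t : {ffun V -> bool}) : bool :=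
  sat lit F [set x in W | s x == t x] s.
Arguments link {I V}.

HB.lock Definition conn (I V : finType) (lit : I -> V -> bool -> bool)
    (F : {set I}) (W : {set V}) : bool :=
  [forall s, forall t,
     sat lit F W s ==> sat lit F W t ==> connect (link lit F W) s t].
Arguments conn {I V}.

HB.lock Definition glue (V : finType) (D : {set V}) (s t : {ffun V -> bool}) :
    {ffun V -> bool} :=
  [ffun x => if x \in D then s x else t x].
Arguments glue {V}.

HB.lock Definition vars (I V : finType) (lit : I -> V -> bool -> bool)
    (F : {set I}) (W : {set V}) : {set V} :=
  [set x in W | [exists i in F, exists b, lit i x b]].
Arguments vars {I V}.

HB.lock Definition unfixed (I V : finType) (lit : I -> V -> bool -> bool)
    (F : {set I}) (x : V) (b : bool) : {set I} :=
  [set j in F | ~~ lit j x b].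
Arguments unfixed {I V}.

HB.lock Definition unsatc (I V : finType) (lit : I -> V -> bool -> bool)
    (F : {set I}) (D : {set V}) (s : {ffun V -> bool}) : {set I} :=
  [set j in F | ~~ satc lit j D s].
Arguments unsatc {I V}.

(** * Formulas, solutions and links *)

Section Formula.
Variables I V : finType.
Implicit Types (i j r : I) (F Q R : {set I}) (x y : V) (A D W : {set V}).
Implicit Types (b c : bool) (s t u : {ffun V -> bool}).
Implicit Type lit : I -> V -> bool -> bool.

Definition unique lit F i x b :=
  lit i x b && [forall j in F, lit j x b ==> (j == i)].
(** Hall's marriage condition for matching clauses to variables, with surplus [k]. *)
Definition hall lit k F W := forall Q,
  Q \subset F -> Q != set0 -> #|Q| + k <= #|vars lit Q W|.

Lemma in_unfixed lit F x b i :
  (i \in unfixed lit F x b) = (i \in F) && ~~ lit i x b.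
Proof. by rewrite unfixed.unlock inE. Qed.

Lemma in_unsatc lit F D s i :
  (i \in unsatc lit F D s) = (i \in F) && ~~ satc lit i D s.
Proof. by rewrite unsatc.unlock inE. Qed.

Definition inFE := (in_unfixed, in_unsatc, inE).

Lemma satcP lit i A s :
  reflect (exists2 x, x \in A & lit i x (s x)) (satc lit i A s).
Proof. by rewrite satc.unlock; apply: exists_inP. Qed.

Lemma satP lit F A s :
  reflect (forall i, i \in F -> satc lit i A s) (sat lit F A s).
Proof. by rewrite sat.unlock; apply: forall_inP. Qed.

Lemma satPn lit F A s :
  reflect (exists2 i, i \in F & ~~ satc lit i A s) (~~ sat lit F A s).
Proof. by rewrite sat.unlock; apply: forall_inPn. Qed.

Lemma linkE lit F W s t :
  link lit F W s t = sat lit F [set x in W | s x == t x] s.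
Proof. by rewrite link.unlock. Qed.

Lemma connP lit F W :
  reflect (forall s t, sat lit F W s -> sat lit F W t ->
             connect (link lit F W) s t) (conn lit F W).
Proof.
rewrite conn.unlock; apply: (iffP forallP) => [h s t ss st|h s].
  by move/forallP: (h s) => /(_ t) /implyP/(_ ss) /implyP; apply.
by apply/forallP=> t; apply/implyP=> ss; apply/implyP=> st; apply: h.
Qed.

Lemma glueE D s t x : glue D s t x = if x \in D then s x else t x.
Proof. by rewrite glue.unlock ffunE. Qed.

Lemma satcS lit i A D s : A \subset D -> satc lit i A s -> satc lit i D s.
Proof.
by move=> /subsetP AD /satcP[x xA lx]; apply/satcP; exists x => //; apply: AD.
Qed.

Lemma satS lit F Q A D s :
  Q \subset F -> A \subset D -> sat lit F A s -> sat lit Q D s.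
Proof.
move=> /subsetP QF AD /satP h; apply/satP => i iQ.
by apply: satcS AD _; apply: h; apply: QF.
Qed.

Lemma eq_satc lit i A s t :
  {in A, s =1 t} -> satc lit i A s = satc lit i A t.
Proof.
by move=> st; apply/satcP/satcP=> -[x xA lx]; exists x => //;
  rewrite ?st // -st.
Qed.

Lemma eq_sat lit F A s t : {in A, s =1 t} -> sat lit F A s = sat lit F A t.
Proof.
move=> st; apply/satP/satP=> h i iF; move: (h i iF);
by rewrite (eq_satc _ _ st).
Qed.

Lemma sat_split lit F W D s i :
  sat lit F W s -> i \in F -> satc lit i D s || satc lit i (W :\: D) s.
Proof.
move=> /satP h /h /satcP[x xW lx]; case: (boolP (x \in D)) => xD; apply/orP.
  by left; apply/satcP; exists x.
by right; apply/satcP; exists x => //; rewrite inFE xD.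
Qed.

(** * Gluing assignments, and paths between glued solutions *)

Lemma glue_in D s t : {in D, glue D s t =1 s}.
Proof. by move=> x xD; rewrite glueE xD. Qed.

Lemma glue_out W D s t : {in W :\: D, glue D s t =1 t}.
Proof. by move=> x; rewrite inFE glueE => /andP[/negPf->]. Qed.

Lemma glue_id D s : glue D s s = s.
Proof. by apply/ffunP=> x; rewrite glueE if_same. Qed.

Lemma glue_agree D s t : {in D, s =1 t} -> glue D s t = t.
Proof. by move=> st; apply/ffunP=> x; rewrite glueE; case: ifP => // /st. Qed.

Lemma satc_glue_in lit i D s t : satc lit i D (glue D s t) = satc lit i D s.
Proof. exact: eq_satc (@glue_in _ _ _). Qed.

Lemma sat_glue lit F W D s t : D \subset W ->
  (forall i, i \in F -> satc lit i D s || satc lit i (W :\: D) t) ->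
  sat lit F W (glue D s t).
Proof.
move=> DW h; apply/satP=> i /h /orP[] si.
  by apply: satcS DW _; rewrite satc_glue_in.
apply: satcS (subsetDl W D) _; rewrite (eq_satc lit i (t := t)) //.
exact: glue_out.
Qed.

Lemma linkP lit F W s t :
  reflect (forall i, i \in F ->
             exists x, [/\ x \in W, s x = t x & lit i x (s x)])
          (link lit F W s t).
Proof.
rewrite linkE; apply: (iffP (satP _ _ _ _)) => h i iF; move: (h i iF).
  by case/satcP=> x; rewrite inFE => /andP[xW /eqP st] lx; exists x.
by case=> x [xW st lx]; apply/satcP; exists x => //; rewrite inFE xW st /=.
Qed.

Lemma link_sym lit F W : symmetric (link lit F W).
Proof.
move=> s t; apply/linkP/linkP => h i /h [x [xW st lx]]; exists x;
by rewrite st -?st.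
Qed.

Lemma connect_link_sym lit F W s t :
  connect (link lit F W) s t = connect (link lit F W) t s.
Proof. exact: (sym_connect_sym (@link_sym lit F W)). Qed.

Lemma link_satl lit F W s t : link lit F W s t -> sat lit F W s.
Proof.
by rewrite linkE; apply: satS => //; apply/subsetP=> x; rewrite inFE => /andP[].
Qed.

Lemma link_satr lit F W s t : link lit F W s t -> sat lit F W t.
Proof. by rewrite link_sym; apply: link_satl. Qed.

Lemma connect_sat lit F W s t :
  connect (link lit F W) s t -> sat lit F W s -> sat lit F W t.
Proof.
move=> st ss; move: t st; apply: connect_ind => // y z _ _; exact: link_satr.
Qed.

Lemma linkS lit F Q A W s t : Q \subset F -> A \subset W ->
  link lit F A s t -> link lit Q W s t.
Proof.
move=> QF AW; rewrite !linkE; apply: satS QF _; apply/subsetP=> x; rewrite !inFE.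
by case/andP=> /(subsetP AW)->.
Qed.

Lemma link_agree lit F W A s t : A \subset W -> {in A, s =1 t} ->
  sat lit F A s -> link lit F W s t.
Proof.
move=> AW st; rewrite linkE; apply: satS => //; apply/subsetP=> x xA.
by rewrite inFE (subsetP AW) //= st.
Qed.

Lemma link_glue lit F W D s s' t t' : D \subset W ->
  (forall i, i \in F -> satc lit i [set x in D | s x == s' x] s
     || satc lit i [set x in W :\: D | t x == t' x] t) ->
  link lit F W (glue D s t) (glue D s' t').
Proof.
move=> DW h; apply/linkP=> i /h /orP[] /satcP[x].
  rewrite inFE => /andP[xD /eqP e] lx; exists x; rewrite !(glueE, ffunE) xD.
  by split=> //; apply: (subsetP DW).
rewrite !inFE => /andP[/andP[/negPf xD xW] /eqP e] lx; exists x.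
by rewrite !(glueE, ffunE) xD.
Qed.

(** Clauses satisfied on [D] by the fixed values of [s] impose nothing on the outside, so a path for
    the other clauses carries over. *)
Lemma connect_glue_out lit F W D s t t' : D \subset W ->
  connect (link lit (unsatc lit F D s) (W :\: D)) t t' ->
  connect (link lit F W) (glue D s t) (glue D s t').
Proof.
move=> DW; apply: connect_map => u v; rewrite linkE => /satP uv; apply: connect1.
apply: link_glue => // i iF; case: (boolP (satc lit i D s)) => si.
  apply/orP; left; apply: satcS si; apply/subsetP=> x xD.
  by rewrite inFE xD /=.
by apply/orP; right; apply: uv; rewrite inFE iF.
Qed.

Lemma connect_glue_in lit F W D s s' t : D \subset W ->
  connect (link lit (F :\: [set i in F | satc lit i (W :\: D) t]) D) s s' ->
  connect (link lit F W) (glue D s t) (glue D s' t).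
Proof.
move=> DW; apply: (@connect_map _ _ _ _ (fun v => glue D v t)) => u v.
rewrite linkE => /satP uv; apply: connect1.
apply: link_glue => // i iF; case: (boolP (satc lit i (W :\: D) t)) => si.
  apply/orP; right; apply: satcS si; apply/subsetP=> x xD.
  by rewrite inFE xD /=.
by apply/orP; left; apply: uv; rewrite !inFE iF /= si.
Qed.

Lemma connect_linkS lit F Q A W s t : Q \subset F -> A \subset W ->
  connect (link lit F A) s t -> connect (link lit Q W) s t.
Proof.
move=> QF AW c; apply: (connect_map (f := id) _ c) => u v uv.
exact/connect1/(linkS QF AW uv).
Qed.

Lemma unsatc_sat lit F W D s t : {in D, s =1 t} ->
  sat lit F W t -> sat lit (unsatc lit F D s) (W :\: D) t.
Proof.
move=> st ht; apply/satP=> i; rewrite inFE => /andP[iF ni].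
by have := sat_split D ht iF; rewrite -(eq_satc _ _ st) (negPf ni).
Qed.

Lemma fiber_connect lit F W D s t : D \subset W -> {in D, s =1 t} ->
  sat lit F W s -> sat lit F W t ->
  conn lit (unsatc lit F D s) (W :\: D) ->
  connect (link lit F W) s t.
Proof.
move=> DW st ss tt /connP cn; rewrite -[t in connect _ _ t](glue_agree st).
rewrite -[s in connect _ s](glue_id D); apply: connect_glue_out => //.
by apply: cn; apply: unsatc_sat.
Qed.

(** * Counting the variables of subformulas *)

Lemma varsP lit F W x :
  reflect (exists i b, [/\ x \in W, i \in F & lit i x b]) (x \in vars lit F W).
Proof.
rewrite vars.unlock inE; apply: (iffP andP) => [[xW /exists_inP[i iF /existsP[b l]]]|].
  by exists i, b.
by case=> i [b [xW iF l]]; split=> //; apply/exists_inP; exists i => //;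
  apply/existsP; exists b.
Qed.

Lemma vars_sub lit F W : vars lit F W \subset W.
Proof. by apply/subsetP=> x /varsP[i [b []]]. Qed.

Lemma varsS lit F Q W A : Q \subset F -> A \subset W ->
  vars lit Q A \subset vars lit F W.
Proof.
move=> QF AW; apply/subsetP=> x /varsP[i [b [xW iF l]]]; apply/varsP.
by exists i, b; split; [apply: (subsetP AW)|apply: (subsetP QF)|].
Qed.

(** Makes the count additive along a split, so that the surplus of [Q :|: R] can be compared with
    those of its two parts. *)
Lemma vars_card_split lit Q R W :
  #|vars lit (Q :|: R) W|
  = #|vars lit Q W| + #|vars lit R (W :\: vars lit Q W)|.
Proof.
rewrite -cardsUI (_ : _ :&: _ = set0) ?cards0 ?addn0; last first.
  apply/setP=> x; rewrite [RHS]inFE; apply/negP; rewrite inFE.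
  by case/andP=> xQ /(subsetP (vars_sub _ _ _)); rewrite inFE xQ.
congr #|pred_of_set _|; apply/setP=> x; apply/idP/setUP.
  move=> /varsP[i [b [xW]]]; rewrite inFE => iQR l.
  case: (boolP (x \in vars lit Q W)) => xQ; [by left|right].
  apply/varsP; exists i, b; rewrite inFE xQ; split=> //.
  case/orP: iQR => // iQ; case/negP: xQ; apply/varsP; by exists i, b.
case; apply: subsetP; apply: varsS => //; rewrite ?subsetUl ?subsetUr //.
exact: subsetDl.
Qed.

Lemma vars_D1 lit Q W x : #|vars lit Q W| <= #|vars lit Q (W :\ x)|.+1.
Proof.
have: vars lit Q W \subset x |: vars lit Q (W :\ x).
  apply/subsetP=> y /varsP[i [b [yW iQ l]]]; rewrite inFE in_set1.
  case: eqP => //= /eqP yx; apply/varsP; exists i, b.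
  by rewrite !inFE yx.
move/subset_leq_card/leq_trans; apply; rewrite cardsU1; case: (_ \notin _); nlia.
Qed.

Lemma vars_in lit Q W D :
  D \subset W -> vars lit Q W \subset D -> vars lit Q D = vars lit Q W.
Proof.
move=> DW QD; apply/eqP; rewrite eqEsubset varsS //=; apply/subsetP=> x xQ.
case/varsP: (xQ) => i [b [xW iQ l]]; apply/varsP; exists i, b.
by split=> //; apply: (subsetP QD).
Qed.

Lemma hallW lit k k' F Q W A : k' <= k -> Q \subset F -> A \subset W ->
  hall lit k F A -> hall lit k' Q W.
Proof.
move=> kk QF AW h Q' Q'Q nz; apply: leq_trans (_ : #|Q'| + k <= _); first nlia.
apply: leq_trans (h _ (subset_trans Q'Q QF) nz) _.
by apply: subset_leq_card; apply: varsS.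
Qed.

Lemma hall_D1 lit k F W x : hall lit k.+1 F W -> hall lit k F (W :\ x).
Proof. by move=> h Q QF nz; have := h Q QF nz; have := vars_D1 lit Q W x; nlia. Qed.

(** * Fixing a variable; satisfiability under Hall's condition *)

Lemma satc_set1 lit i x s : satc lit i [set x] s = lit i x (s x).
Proof.
apply/satcP/idP => [[y]|]; first by rewrite inFE => /eqP->.
by exists x; rewrite ?set11.
Qed.

Lemma fix_sat lit F W x b s : x \in W ->
  sat lit (unfixed lit F x b) (W :\ x) s ->
  sat lit F W (glue [set x] [ffun=> b] s).
Proof.
move=> xW /satP h; apply: sat_glue => [|i iF]; first by rewrite sub1set.
rewrite satc_set1 ffunE; case: (boolP (lit i x b)) => //= l.
by apply: h; rewrite inFE iF.
Qed.

Lemma glue1 x b s : glue [set x] [ffun=> b] s x = b.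
Proof. by rewrite !(glueE, ffunE) set11. Qed.

Lemma unfixed_sub lit F x b : unfixed lit F x b \subset F.
Proof. by apply/subsetP=> i; rewrite inFE => /andP[]. Qed.

(** The inductive proof of Hall's theorem: a proper subformula without surplus is solved on its own
    variables, and Hall's condition survives for the rest on the others. *)
Lemma hall_sat lit F W : hall lit 0 F W -> exists s, sat lit F W s.
Proof.
have [n] := ubnP #|F|; elim: n => // n IH in F W * => /ltnSE Fn hF.
have [->|/set0Pn[i iF]] := eqVneq F set0.
  by exists [ffun=> true]; apply/satP=> i; rewrite inFE.
case: (boolP [exists Q : {set I}, [&& Q \proper F, Q != set0
  & #|vars lit Q W| == #|Q|]]).
  case/existsP=> Q /and3P[QF nz /eqP tQ]; have [QF' ltQ] := (proper_sub QF, proper_card QF).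
  have [||s1 h1] := IH Q W; first by nlia.
    by apply: hallW hF.
  have FE : Q :|: (F :\: Q) = F by apply: setUDK.
  have [||s2 h2] := IH (F :\: Q) (W :\: vars lit Q W).
  - have := cardsD F Q; have := cardsI Q F; rewrite (setIidPr QF').
    have : 0 < #|Q| by rewrite card_gt0.
    nlia.
  - move=> R RF Rnz; have := hF (Q :|: R).
    rewrite vars_card_split tQ cardsU.
    have -> : Q :&: R = set0.
      by apply/setP=> j; rewrite !inFE; apply/negP=> /andP[jQ /(subsetP RF)]; rewrite inFE jQ.
    rewrite cards0 => h; move: h; rewrite subUset QF'.
    by rewrite (subset_trans RF (subsetDl _ _)) setU_eq0 (negPf nz) => /(_ isT isT); nlia.
  exists (glue (vars lit Q W) s1 s2); apply: sat_glue => [|j jF].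
    exact: vars_sub.
  case: (boolP (j \in Q)) => jQ; last first.
    by apply/orP; right; apply: (satP _ _ _ _ h2); rewrite inFE jQ.
  apply/orP; left; have /satcP[x xW l] := satP _ _ _ _ h1 j jQ.
  by apply/satcP; exists x => //; apply/varsP; exists j, (s1 x).
(* Every proper nonempty subformula now has a spare variable, so one variable can be spent on clause
   [i]. *)
move/existsPn=> nt.
have /card_gt0P[x /varsP[j [b [xW]]]] : 0 < #|vars lit [set i] W|.
  have := hF [set i]; rewrite sub1set iF cards1 => h; have := h isT.
  by rewrite -card_gt0 cards1 => /(_ isT); nlia.
rewrite inFE => /eqP-> l.
have pr : unfixed lit F x b \proper F.
  by rewrite properE unfixed_sub; apply/subsetPn; exists i; rewrite // inFE iF l.
have [||s hs] := IH (unfixed lit F x b) (W :\ x).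
- by have := proper_card pr; nlia.
- move=> Q QF nz; have /= := nt Q; rewrite nz (sub_proper_trans QF pr) /=.
  have := hF Q (subset_trans QF (proper_sub pr)) nz.
  have := vars_D1 lit Q W x; nlia.
by exists (glue [set x] [ffun=> b] s); apply: fix_sat.
Qed.

Lemma hall_sat_fix lit F W x b : x \in W ->
  hall lit 0 (unfixed lit F x b) (W :\ x) ->
  exists2 s, sat lit F W s & s x = b.
Proof.
move=> xW /hall_sat[s ss]; exists (glue [set x] [ffun=> b] s).
  exact: fix_sat.
exact: glue1.
Qed.

(** One unit of surplus pays for prescribing one variable. *)
Lemma hall1_sat_fix lit F W x b : x \in W -> hall lit 1 F W ->
  exists2 s, sat lit F W s & s x = b.
Proof.
move=> xW h; apply: hall_sat_fix => //.
exact: hallW (unfixed_sub _ _ _ _) _ (hall_D1 x h).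
Qed.

Lemma half_connect lit F W x s t : x \in W -> s x = t x ->
  sat lit F W s -> sat lit F W t ->
  conn lit (unfixed lit F x (s x)) (W :\ x) ->
  connect (link lit F W) s t.
Proof.
move=> xW st ss tt cn; apply: (@fiber_connect _ _ _ [set x]) => //.
- by rewrite sub1set.
- by move=> y /set1P->.
- rewrite (_ : unsatc _ _ _ _ = unfixed lit F x (s x)) //.
  by apply/setP=> i; rewrite !inFE satc_set1.
Qed.


Lemma sat_vars lit Q W s : sat lit Q W s -> sat lit Q (vars lit Q W) s.
Proof.
move=> /satP h; apply/satP=> i iQ; case/satcP: (h i iQ) => x xW l.
by apply/satcP; exists x => //; apply/varsP; exists i, (s x).
Qed.

Lemma unsatc_rest lit F Q D s : sat lit Q D s -> unsatc lit F D s \subset F :\: Q.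
Proof.
move=> /satP h; apply/subsetP=> i; rewrite !inFE => /andP[-> ni].
by rewrite andbT; apply: contra ni => /h.
Qed.

Lemma sat_glue2 lit F Q W D s t : D \subset W ->
  sat lit Q D s -> sat lit (F :\: Q) (W :\: D) t -> sat lit F W (glue D s t).
Proof.
move=> DW /satP sQ /satP tR; apply: sat_glue => // i iF.
case: (boolP (i \in Q)) => iQ; first by rewrite sQ.
by rewrite tR ?orbT // inFE iQ.
Qed.

(** Once [t] satisfies the remaining clauses outside [D], only [Q] constrains the values on [D]. *)
Lemma connect_slide lit F Q W D s s' t : D \subset W -> conn lit Q D ->
  sat lit (F :\: Q) (W :\: D) t -> sat lit Q D s -> sat lit Q D s' ->
  connect (link lit F W) (glue D s t) (glue D s' t).
Proof.
move=> DW /connP cQ /satP tR sQ s'Q; apply: connect_glue_in => //.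
apply: connect_linkS (cQ _ _ sQ s'Q) => //; apply/subsetP=> i.
rewrite !inFE => /andP[ni iF]; move: ni; rewrite iF /=; apply: contraR => iQ.
by apply: tR; rewrite inFE iQ.
Qed.

Lemma cardsU_rest F Q R : R \subset F :\: Q -> #|Q :|: R| = #|Q| + #|R|.
Proof.
rewrite subsetD disjoint_sym => /andP[_ /disjoint_setI0 d].
by rewrite cardsU d cards0 subn0.
Qed.

Lemma subU_rest F Q R : Q \subset F -> R \subset F :\: Q -> Q :|: R \subset F.
Proof. by move=> QF; rewrite subUset QF subsetD => /andP[]. Qed.

Lemma cards_rest F Q : Q \subset F -> #|F| = #|Q| + #|F :\: Q|.
Proof. by move=> QF; rewrite -(cardsU_rest (F := F)) // setUDK. Qed.

Lemma hall_vars lit k Q W D : D \subset W -> vars lit Q W \subset D ->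
  hall lit k Q W -> hall lit k Q D.
Proof.
move=> DW QD h Q' Q'Q nz; rewrite (vars_in (W := W)) ?h //.
by apply: subset_trans QD; apply: varsS.
Qed.

Lemma varsE lit Q W x b i : x \in W -> i \in Q -> lit i x b ->
  x \in vars lit Q W.
Proof. by move=> xW iQ l; apply/varsP; exists i, b. Qed.

Lemma has_lit lit Q W : 0 < #|vars lit Q W| ->
  exists i x b, [/\ i \in Q, x \in W & lit i x b].
Proof. by move=> /card_gt0P[x /varsP[i [b []]]]; exists i, x, b. Qed.

Lemma unfixed_proper lit F x b i :
  i \in F -> lit i x b -> unfixed lit F x b \proper F.
Proof.
move=> iF l; rewrite properE unfixed_sub; apply/subsetPn; exists i => //.
by rewrite inFE iF l.
Qed.

(** * Connectedness of the set of solutions under surplus one *)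

Lemma conn0 lit W : conn lit set0 W.
Proof. by apply/connP=> s t _ _; apply/connect1/linkP=> i; rewrite inFE. Qed.

Lemma conn_via lit F W (P : {ffun V -> bool} -> Prop) :
  (forall s, sat lit F W s -> exists2 s', P s' & connect (link lit F W) s s') ->
  (forall s t, P s -> P t -> connect (link lit F W) s t) -> conn lit F W.
Proof.
move=> toP cP; apply/connP=> s t /toP[s' Ps ss'] /toP[t' Pt tt'].
apply: connect_trans ss' (connect_trans (cP _ _ Ps Pt) _).
by rewrite connect_link_sym.
Qed.

(** Every solution is brought to agree with [t0] outside the variables of [Q], where the
    connectedness of [Q] takes over. The outside can be replaced as soon as the inside satisfies one
    of the remaining clauses, since those still open form a proper subformula. Failing that, the
    outside satisfies all of them and the inside can slide to [t]. *)
Lemma conn_extend lit F Q W t0 :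
  Q \subset F -> conn lit Q (vars lit Q W) ->
  sat lit (F :\: Q) (W :\: vars lit Q W) t0 ->
  (forall R, R \proper F :\: Q -> conn lit R (W :\: vars lit Q W)) ->
  conn lit (F :\: Q) (W :\: vars lit Q W) \/
    (exists r t, [/\ r \in F :\: Q, sat lit Q (vars lit Q W) t
                  & satc lit r (vars lit Q W) t]) ->
  conn lit F W.
Proof.
set D := vars lit Q W; set R := F :\: Q; set O := W :\: D.
move=> QF cQ rho cR disj; have DW : D \subset W by apply: vars_sub.
have satQ s : sat lit F W s -> sat lit Q D s.
  by move=> ss; apply: sat_vars; apply: satS ss.
have satrho s : sat lit Q D s -> sat lit F W (glue D s t0).
  by move=> ss; apply: sat_glue2 rho.
have fib s : sat lit F W s -> conn lit R O \/
    (exists2 r, r \in R & satc lit r D s) ->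
    connect (link lit F W) s (glue D s t0).
  move=> ss h; apply: (@fiber_connect _ _ _ D) => //.
  - by move=> x xD; rewrite glue_in.
  - by apply: satrho; apply: satQ.
  have := unsatc_rest F (satQ _ ss); rewrite -/R subEproper.
  case/orP=> [/eqP e|]; last exact: cR.
  rewrite e; case: h => // -[r rR sr]; move: (rR); rewrite -e in_unsatc sr.
  by rewrite andbF.
apply: (@conn_via _ _ _ (fun s => exists2 t, sat lit Q D t & s = glue D t t0)).
  move=> s ss; case: disj => [cRO|[r [t [rR tQ tr]]]].
    by exists (glue D s t0); [exists s => //; apply: satQ|apply: fib => //; left].
  case: (boolP [exists r in R, satc lit r D s]) => [/exists_inP h|/exists_inPn no].
    by exists (glue D s t0); [exists s => //; apply: satQ|apply: fib => //; right].
  have sO : sat lit R O s.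
    apply/satP=> k kR; have kF : k \in F by move: kR; rewrite inFE => /andP[].
    by have := sat_split D ss kF; rewrite (negPf (no k kR)).
  exists (glue D t t0); first by exists t.
  apply: (@connect_trans _ _ (glue D t s)).
    rewrite -{1}(glue_id D s); apply: connect_slide sO (satQ _ ss) tQ => //.
  have -> : glue D t t0 = glue D (glue D t s) t0.
    by apply/ffunP=> y; rewrite !glueE; case: ifP.
  apply: fib; first exact: sat_glue2 tQ sO.
  by right; exists r; rewrite ?satc_glue_in.
by move=> _ _ [t tQ ->] [t' t'Q ->]; apply: connect_slide rho tQ t'Q.
Qed.

Lemma hall1_conn lit F W : hall lit 1 F W -> conn lit F W.
Proof.
have [n] := ubnP #|F|; elim: n => // n IH in F W * => /ltnSE Fn hF.
have [->|Fnz] := eqVneq F set0; first exact: conn0.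
pose tight Q := [&& Q \proper F, Q != set0 & #|vars lit Q W| == #|Q|.+1].
case: (boolP [exists Q, tight Q]) => [/existsP|/existsPn nt].
  case/(@max_card_set _ tight) => Q /and3P[prQ Qnz /eqP tQ] maxQ.
  have QF := proper_sub prQ.
  set D := vars lit Q W in tQ *; set R := F :\: Q; set O := W :\: D.
  have DW : D \subset W by apply: vars_sub.
  have cQR := cards_rest QF; rewrite -/R in cQR.
  have Q0 : 0 < #|Q| by rewrite card_gt0.
  have ltQ := proper_card prQ.
  (* Maximality of [Q] gives surplus one off [D] to every nonempty proper subformula of [R]. *)
  have surR R' : R' \subset R -> R' != set0 -> #|R'| <= #|vars lit R' O| /\
      (R' != R -> #|R'| < #|vars lit R' O|).
    move=> sR nz; have sQR := subU_rest QF sR.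
    have QRnz : Q :|: R' != set0 by rewrite setU_eq0 (negPf Qnz).
    have := hF _ sQR QRnz; rewrite vars_card_split (cardsU_rest sR) -/D tQ -/O.
    move=> le1; split=> [|R'R]; first nlia.
    rewrite ltnNge; apply/negP=> le2.
    have /maxQ : tight (Q :|: R').
      rewrite /tight QRnz vars_card_split (cardsU_rest sR) -/D tQ -/O.
      rewrite properEcard sQR cQR (cardsU_rest sR) ltn_add2l.
      rewrite proper_card ?properEneq ?R'R //=; nlia.
    by rewrite (cardsU_rest sR); move: nz; rewrite -card_gt0; nlia.
  have hR : hall lit 0 R O by move=> R' sR nz; case: (surR R' sR nz); nlia.
  have [rho rhoR] := hall_sat hR.
  have hQ : hall lit 1 Q D := hall_vars DW (subxx D) (hallW (leqnn 1) QF (subxx W) hF).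
  have cQ : conn lit Q D by apply: IH; [nlia|].
  have cRp R' : R' \proper R -> conn lit R' O.
    move=> pr; have := proper_card pr => ?; apply: IH; first nlia.
    move=> R1 sR nz; rewrite addn1.
    apply: (surR R1 (subset_trans sR (proper_sub pr)) nz).2.
    by apply: contraTneq pr => <-; rewrite properE sR andbF.
  apply: (conn_extend QF cQ rhoR cRp).
  have [/exists_inP[r rR /exists_inP[x xD /existsP[b l]]]|no] :=
    boolP [exists r in R, [exists x in D, [exists b, lit r x b]]].
    right; have [t tQ' tx] := hall1_sat_fix b xD hQ.
    by exists r, t; split=> //; apply/satcP; exists x; rewrite ?tx.
  (* No clause of [R] has a literal on [D], so restricting [R] to [O] loses no variable. *)
  left; apply: IH; rewrite -/R; first by nlia.
  move=> R' sR nz; have R'F := subset_trans sR (subsetDl F Q).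
  have -> : vars lit R' O = vars lit R' W; last exact: hF.
  apply: vars_in; first exact: subsetDl.
  apply/subsetP=> x /varsP[i [b [xW iR l]]]; rewrite inFE xW andbT.
  apply: contra no => xD; apply/exists_inP; exists i; first exact: (subsetP sR).
  by apply/exists_inP; exists x => //; apply/existsP; exists b.
(* Every nonempty proper subformula now has surplus two. A solution [s0] that does not rely on [x]
   extends by both values of [x], the two extensions are linked, and all solutions with [x = c]
   reach one of them whenever that literal occurs. *)
have [|j [x [b [jF xW l]]]] := @has_lit lit F W.
  by have := hF F (subxx _) Fnz; nlia.
have [s0 ss0] := hall_sat (hall_D1 x hF).
have sub1 : [set x] \subset W by rewrite sub1set.
pose h c := glue [set x] [ffun=> c] s0.
have hx c : h c x = c by apply: glue1.
have satW (y u : {ffun V -> bool}) : sat lit F (W :\ x) u ->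
    (forall z, z != x -> y z = u z) -> sat lit F (W :\ x) y.
  by move=> uu yu; rewrite (@eq_sat _ _ _ _ u) // => z; rewrite !inFE => /andP[/yu].
have sh c : sat lit F (W :\ x) (h c).
  by apply: satW ss0 _ => z zx; rewrite !(glueE, ffunE) inFE (negPf zx).
have shW c : sat lit F W (h c) by apply: satS (sh c) => //; apply: subsetDl.
have half k c : k \in F -> lit k x c -> forall s, sat lit F W s -> s x = c ->
    connect (link lit F W) s (h c).
  move=> kF lk s ss sx; apply: (@half_connect _ _ _ x) => //; first by rewrite hx.
  rewrite sx; have pr := unfixed_proper kF lk; have := proper_card pr => ?.
  apply: IH; first nlia.
  move=> Q sQ nz; have QF := subset_trans sQ (proper_sub pr).
  have := nt Q; rewrite /tight nz (sub_proper_trans sQ pr) /=.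
  by have := hF Q QF nz; have := vars_D1 lit Q W x; nlia.
have hh c c' : connect (link lit F W) (h c) (h c').
  apply/connect1/(link_agree (A := W :\ x)) => //; first exact: subsetDl.
  by move=> z; rewrite !inFE => /andP[/negPf zx _]; rewrite !(glueE, ffunE) inFE zx.
apply: (@conn_via _ _ _ (fun s => s = h b)) => [s ss|s t -> ->] //.
exists (h b) => //; case: (eqVneq (s x) b) => [sx|sx]; first exact: half l _ ss sx.
case: (boolP [exists k in F, lit k x (s x)]) => [/exists_inP[k kF lk]|].
  exact: connect_trans (half _ _ kF lk _ ss erefl) (hh _ _).
move/exists_inPn => no; pose s' := glue [set x] [ffun=> b] s.
have ssx : sat lit F (W :\ x) s.
  apply/satP=> k kF; case/satcP: (satP _ _ _ _ ss k kF) => z zW lz.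
  apply/satcP; exists z => //; rewrite !inFE zW andbT.
  by apply: contraTneq lz => ->; apply: no.
have eqs : forall z, z != x -> s' z = s z.
  by move=> z zx; rewrite !(glueE, ffunE) inFE (negPf zx).
apply: (@connect_trans _ _ s').
  apply/connect1/(link_agree (A := W :\ x)) => //; first exact: subsetDl.
  by move=> z; rewrite !inFE => /andP[zx _]; rewrite eqs.
apply: half l _ _ _ => //; last exact: glue1.
by apply: satS (satW _ _ ssx eqs) => //; apply: subsetDl.
Qed.

(* Clause r0 takes over the role of all of R, of which it becomes the
   disjunction. *)
Definition merge lit R r0 i x b :=
  if i == r0 then [exists r in R, lit r x b] else lit i x b.

Lemma mergeQ lit F Q r0 i x b : r0 \in F :\: Q -> i \in Q ->
  merge lit (F :\: Q) r0 i x b = lit i x b.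
Proof.
rewrite /merge inFE => /andP[r0Q _] iQ; case: eqP => // e.
by rewrite -e iQ in r0Q.
Qed.

Lemma mergeR lit R r0 x b :
  reflect (exists2 r, r \in R & lit r x b) (merge lit R r0 r0 x b).
Proof. by rewrite /merge eqxx; apply: exists_inP. Qed.

Lemma merge_satcQ lit F Q r0 i A s : r0 \in F :\: Q -> i \in Q ->
  satc (merge lit (F :\: Q) r0) i A s = satc lit i A s.
Proof.
by move=> r0R iQ; apply/satcP/satcP => -[x xA l]; exists x => //; move: l;
  rewrite mergeQ.
Qed.

Lemma merge_satcR lit R r0 A s :
  reflect (exists2 r, r \in R & satc lit r A s)
          (satc (merge lit R r0) r0 A s).
Proof.
apply: (iffP (satcP _ _ _ _)) => [[x xA /mergeR[r rR l]]|[r rR /satcP[x xA l]]].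
  by exists r => //; apply/satcP; exists x.
by exists x => //; apply/mergeR; exists r.
Qed.

Lemma merge_satQ lit F Q r0 A s : r0 \in F :\: Q ->
  sat (merge lit (F :\: Q) r0) Q A s = sat lit Q A s.
Proof.
by move=> r0R; apply/satP/satP=> h i iQ; move: (h i iQ); rewrite merge_satcQ.
Qed.

Lemma merge_sat lit F Q r0 A s : r0 \in F :\: Q ->
  reflect (sat lit Q A s /\ exists2 r, r \in F :\: Q & satc lit r A s)
    (sat (merge lit (F :\: Q) r0) (r0 |: Q) A s).
Proof.
move=> r0R; apply: (iffP idP) => [/satP h|[/satP sQ sR]].
  split; last by apply/merge_satcR/h; rewrite setU11.
  by rewrite -(merge_satQ _ _ _ r0R); apply/satP=> i iQ; apply: h; rewrite setU1r.
apply/satP=> i /setU1P[->|iQ]; first exact/merge_satcR.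
by rewrite merge_satcQ // sQ.
Qed.

Lemma merge_varsQ lit F Q Q' r0 A : r0 \in F :\: Q -> Q' \subset Q ->
  vars (merge lit (F :\: Q) r0) Q' A = vars lit Q' A.
Proof.
move=> r0R /subsetP QQ; apply/setP=> x.
by apply/varsP/varsP=> -[i [b [xA iQ l]]]; exists i, b; split=> //;
  move: l; rewrite (mergeQ _ _ _ r0R) ?QQ.
Qed.

Lemma merge_varsU lit F Q Q' r0 A : r0 \in F :\: Q -> Q' \subset Q ->
  vars (merge lit (F :\: Q) r0) (r0 |: Q') A = vars lit (Q' :|: (F :\: Q)) A.
Proof.
move=> r0R /subsetP QQ; apply/setP=> x.
apply/varsP/varsP=> -[i [b [xA]]].
  case/setU1P=> [->/mergeR[r rR l]|iQ].
    by exists r, b; split=> //; rewrite inFE rR orbT.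
  by rewrite mergeQ ?QQ // => l; exists i, b; split=> //; rewrite inFE iQ.
case/setUP=> [iQ l|iR l].
  by exists i, b; split; rewrite ?setU1r ?mergeQ ?QQ.
exists r0, b; split; rewrite ?setU11 //; apply/mergeR; by exists i.
Qed.

(** * Literals owned by a single clause *)

Lemma uniqueP lit F i x b :
  reflect (lit i x b /\ forall j, j \in F -> lit j x b -> j = i)
          (unique lit F i x b).
Proof.
apply: (iffP andP) => -[l h]; split=> //.
  by move=> j jF lj; apply/eqP; move/forall_inP: h => /(_ j jF) /implyP; apply.
by apply/forall_inP=> j jF; apply/implyP=> /(h j jF)->.
Qed.

(** A clause of [F :\: Q] sharing the literal would pass it on to [r0], which differs from [i]. *)
Lemma merge_uniqueQ lit F Q r0 i x b : Q \subset F -> r0 \in F :\: Q ->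
  i \in Q -> unique (merge lit (F :\: Q) r0) (r0 |: Q) i x b ->
  unique lit F i x b.
Proof.
move=> QF r0R iQ /uniqueP[]; rewrite mergeQ // => l h.
apply/uniqueP; split=> // j jF lj; case: (boolP (j \in Q)) => jQ.
  by apply: h; rewrite ?mergeQ // setU1r.
have e : r0 = i by apply: h (setU11 _ _) _; apply/mergeR; exists j; rewrite // inFE jQ.
by move: r0R; rewrite e inFE iQ.
Qed.

Lemma merge_uniqueR lit F Q r0 x b : r0 \in F :\: Q ->
  unique (merge lit (F :\: Q) r0) (r0 |: Q) r0 x b ->
  (exists2 r, r \in F :\: Q & lit r x b) /\ forall j, j \in Q -> ~~ lit j x b.
Proof.
move=> r0R /uniqueP[/mergeR l h]; split=> // j jQ; apply/negP=> lj.
have e : j = r0 by apply: h; rewrite ?setU1r ?mergeQ.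
by move: r0R; rewrite -e inFE jQ.
Qed.

Lemma unique_rest lit F Q W i x b : x \in W :\: vars lit Q W ->
  unique lit (F :\: Q) i x b -> unique lit F i x b.
Proof.
rewrite inFE => /andP[xQ xW] /uniqueP[l h]; apply/uniqueP; split=> // j jF lj.
case: (boolP (j \in Q)) => jQ; last by apply: h; rewrite // inFE jQ.
by case/negP: xQ; apply/varsP; exists j, b.
Qed.

Lemma merge_card lit F Q r0 : r0 \in F :\: Q -> #|r0 |: Q| = #|Q|.+1.
Proof. by rewrite inFE cardsU1 => /andP[-> _]. Qed.

(** Origin of the recurring [+ 2]: fixing a shared literal satisfies both [i] and [j]. *)
Lemma unfixed_card lit F i j x b : i \in F -> j \in F -> i != j ->
  lit i x b -> lit j x b -> #|unfixed lit F x b| + 2 <= #|F|.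
Proof.
move=> iF jF ij li lj.
have: unfixed lit F x b \subset F :\ i :\ j.
  apply/subsetP=> k; rewrite !inFE => /andP[kF lk]; rewrite kF andbT.
  by apply/andP; split; apply: contraNneq lk => ->.
move/subset_leq_card; rewrite (cardsD1 i F) iF (cardsD1 j (F :\ i)).
by rewrite !inFE jF eq_sym ij /=; nlia.
Qed.

(** * Minimal unsatisfiable formulas *)

Lemma unsat_hall lit F W : (forall s, ~~ sat lit F W s) ->
  (forall i, i \in F -> exists s, sat lit (F :\ i) W s) ->
  #|F| = #|vars lit F W|.+1 ->
  forall Q, Q \proper F -> #|Q| <= #|vars lit Q W|.
Proof.
move=> unsat minF cF Q0 prQ0; rewrite leqNgt; apply/negP=> lt0.
pose bad Q := (Q \proper F) && (#|vars lit Q W| < #|Q|).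
have [|Q /andP[prQ ltQ] maxQ] := @max_card_set _ bad; first by exists Q0; apply/andP.
have QF := proper_sub prQ; have cQR := cards_rest QF.
(* Maximality of [Q], and the count [cF] when the union is all of [F], give Hall's condition off the
   variables of [Q]; a solution of [Q] would then extend to [F]. *)
have [|t tR] := @hall_sat lit (F :\: Q) (W :\: vars lit Q W).
  move=> R sR; rewrite -card_gt0 => nz; have sQR := subU_rest QF sR.
  have := vars_card_split lit Q R W; have := cardsU_rest sR => c1 c2.
  have [e|ne] := eqVneq (Q :|: R) F; first by rewrite e in c1 c2; nlia.
  have : ~~ bad (Q :|: R) by apply/negP=> /maxQ; nlia.
  by rewrite /bad properEneq ne sQR /=; nlia.
have [i iF iQ] : exists2 i, i \in F & i \notin Q.
  by case/properP: prQ => _ [i]; exists i.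
have [s ss] := minF i iF.
have sQ : sat lit Q W s.
  apply: satS ss => //; apply/subsetP=> j jQ; rewrite !inFE (subsetP QF) // andbT.
  by apply: contraNneq iQ => <-.
apply: (negP (unsat (glue (vars lit Q W) s t))).
exact: sat_glue2 (vars_sub _ _ _) (sat_vars sQ) tR.
Qed.

(** The extremal case of Tarsi's lemma. A subformula with as many variables as clauses cuts the
    formula into two smaller minimal unsatisfiable ones: the remaining clauses off [D], and [Q] with
    those clauses merged into one, on [D]. Without such a subformula every literal is unique. A
    single clause is excluded, as it would have no variable. *)
Lemma min_unsat_unique lit F W :
  (forall s, ~~ sat lit F W s) ->
  (forall i, i \in F -> exists s, sat lit (F :\ i) W s) ->
  #|F| = #|vars lit F W|.+1 -> 1 < #|F| ->
  forall i, i \in F -> exists x b, x \in W /\ unique lit F i x b.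
Proof.
have [n] := ubnP #|F|; elim: n => // n IH in lit F W *.
move=> /ltnSE Fn unsat minF cF F1.
have hall0 := unsat_hall unsat minF cF.
have sat_proper Q : Q \proper F -> exists s, sat lit Q W s.
  case/properP=> QF [i iF iQ]; have [s ss] := minF i iF.
  exists s; apply: satS ss => //; apply/subsetP=> j jQ.
  rewrite !inFE (subsetP QF) // andbT.
  by apply: contraNneq iQ => <-.
pose tight Q := [&& Q \subset F, Q != set0, #|vars lit Q W| == #|Q| & #|Q| + 2 <= #|F|].
case: (boolP [exists Q, tight Q]) => [/existsP|/existsPn nt].
  case/(@max_card_set _ tight) => Q /and4P[QF Qnz /eqP tQ leQ] maxQ.
  set D := vars lit Q W in tQ *; set R := F :\: Q; set O := W :\: D.
  have DW : D \subset W by apply: vars_sub.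
  have cQR := cards_rest QF; rewrite -/R in cQR.
  have Q0 : 0 < #|Q| by rewrite card_gt0.
  have cO : #|R| = #|vars lit R O|.+1.
    by have := vars_card_split lit Q R W; rewrite setUDK // -/D -/O; nlia.
  have prQ : Q \proper F by rewrite properEcard QF; nlia.
  have [s0 s0Q] := sat_proper Q prQ.
  have s0D : sat lit Q D s0 by apply: sat_vars.
  have unsatR s : ~~ sat lit R O s.
    by apply: contra (unsat (glue D s0 s)) => sR; apply: sat_glue2 sR.
  have hallR R' : R' \proper R -> hall lit 0 R' O.
    move=> pr R1 sR1 nz; have pr1 := sub_proper_trans sR1 pr.
    have sQR := subU_rest QF (proper_sub pr1).
    have c2 := cardsU_rest (proper_sub pr1); have := vars_card_split lit Q R1 W.
    rewrite -/D -/O; have := proper_card pr1 => lt1 c1.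
    have := hall0 (Q :|: R1); rewrite properEcard sQR; nlia.
  have satR r : r \in R -> exists s, sat lit (R :\ r) O s.
    by move=> rR; apply: hall_sat (hallR _ _); apply: properD1.
  have [r0 r0R] : exists r, r \in R by apply/card_gt0P; nlia.
  have cF1 := merge_card lit r0R.
  move=> i iF; case: (boolP (i \in Q)) => iQ; last first.
    have [|||x [b [xO u]]] := IH lit R O _ unsatR satR cO _ i _;
      [by nlia | by nlia | |].
      by rewrite inFE iQ.
    by exists x, b; split; [move: xO; rewrite inFE => /andP[] | apply: unique_rest xO u].
  have varsQD Q' : Q' \subset Q -> vars lit Q' D = vars lit Q' W.
    by move=> sQ; apply: vars_in => //; apply: varsS.
  have [||||||x [b [xD u]]] := IH (merge lit R r0) (r0 |: Q) D _ _ _ _ _ i _.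
  - by nlia.
  - move=> s; apply/negP=> /(merge_sat _ _ _ r0R)[sQ [r rR sr]].
    have [t tR] := satR r rR.
    apply: (negP (unsat (glue D s t))); apply: sat_glue => // j jF.
    case: (boolP (j \in Q)) => jQ; first by rewrite (satP _ _ _ _ sQ).
    have [->|jr] := eqVneq j r; first by rewrite sr.
    by rewrite (satP _ _ _ _ tR) ?orbT // !inFE jr jQ.
  - move=> j /setU1P[->|jQ].
      exists s0; have sQ : sat (merge lit R r0) Q D s0 by rewrite merge_satQ.
      apply: satS _ (subxx D) sQ; apply/subsetP=> k.
      by rewrite !inFE => /andP[/negPf->].
    have [s ss] := minF j (subsetP QF _ jQ); exists s.
    apply/satP=> k; rewrite !inFE => /andP[kj /orP[/eqP->|kQ]]; last first.
      rewrite merge_satcQ //; have := satP _ _ _ _ ss k.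
      rewrite !inFE kj (subsetP QF) // => /(_ isT) /satcP[x xW l].
      by apply/satcP; exists x => //; apply/varsP; exists k, (s x).
    (* If [s] satisfied no clause of [R] on [D], it would satisfy all of [R] off [D]. *)
    apply/merge_satcR; apply/exists_inP; apply: contraT => /exists_inPn no.
    case/negP: (unsatR s); apply/satP=> r rR.
    have rF : r \in F :\ j.
      move: rR; rewrite !inFE => /andP[rQ ->]; rewrite andbT.
      by apply: contraNneq rQ => ->.
    by have := sat_split D ss rF; rewrite (negPf (no r rR)).
  - rewrite cF1 -tQ; congr _.+1; rewrite merge_varsU // setUDK //.
    apply/esym/eqP; rewrite eqn_leq !subset_leq_card ?vars_sub //.
    apply/subsetP=> x /varsP[j [c [xW jQ l]]].
    exact: varsE (varsE xW jQ l) (subsetP QF _ jQ) l.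
  - by nlia.
  - by rewrite setU1r.
  by exists x, b; split; [apply: (subsetP DW) | apply: merge_uniqueQ u].
move=> i iF.
have [|j [x [b [ji xW l]]]] := @has_lit lit [set i] W.
  have := hall0 [set i]; rewrite cards1; apply.
  by rewrite properEcard sub1set iF cards1.
move: ji l; rewrite inFE => /eqP-> l.
(* Any literal of [i] will do: were it shared, fixing it would dispose of two clauses and leave
   Hall's condition, hence a solution. *)
exists x, b; split=> //; apply/uniqueP; split=> // k kF lk.
apply/eqP; apply: contraT => ki.
have le := unfixed_card kF iF ki lk l.
have [|s ss _] := @hall_sat_fix lit F W x b xW; last by case/negP: (unsat s).
move=> Q sQ nz; have cQ := subset_leq_card sQ.
have QF := subset_trans sQ (unfixed_sub _ _ _ _).
have le2 : #|Q| + 2 <= #|F| by nlia.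
have lt : #|Q| < #|vars lit Q W|.
  have := nt Q; rewrite /tight QF nz le2 andbT /= ltn_neqAle eq_sym => -> /=.
  by apply: hall0; rewrite properEcard QF; nlia.
have := vars_D1 lit Q W x; nlia.
Qed.

(** * Formulas with as many clauses as variables *)

Definition critical lit F W :=
  #|F| = #|vars lit F W| /\
  (forall Q, Q \proper F -> Q != set0 -> #|Q| < #|vars lit Q W|).

(** The statement carried by the induction. The first half proves connectedness of formulas in which
    some literal of an occurring variable is absent; the second yields a unique literal within a
    prescribed component. *)
Definition rich lit F W :=
  (forall x b, x \in vars lit F W -> exists2 i, i \in F & lit i x b) /\
  (forall i s, i \in F -> sat lit F W s ->
     exists2 t, connect (link lit F W) s t &
     exists2 x, x \in W & unique lit F i x (t x)).

Definition rich_below n := forall lit F W,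
  #|F| < n -> critical lit F W -> ~~ conn lit F W -> rich lit F W.

Lemma nonuniqueP lit F i x b : lit i x b -> ~~ unique lit F i x b ->
  exists j, [/\ j \in F, j != i & lit j x b].
Proof.
rewrite /unique => -> /= /forall_inPn[j jF].
by rewrite negb_imply => /andP[l ji]; exists j.
Qed.

Lemma nonunique_card lit F i x b : i \in F -> lit i x b ->
  ~~ unique lit F i x b -> #|unfixed lit F x b| + 2 <= #|F|.
Proof.
move=> iF l /(nonuniqueP l)[j [jF ji lj]].
by apply: unfixed_card iF jF _ l lj; rewrite eq_sym.
Qed.

Lemma glue1_out x b s A : {in A :\ x, glue [set x] [ffun=> b] s =1 s}.
Proof. by move=> z; rewrite !inFE => /andP[/negPf zx _]; rewrite glueE inFE zx. Qed.

Lemma glue1_id x s : glue [set x] [ffun=> s x] s = s.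
Proof. by apply: glue_agree => z /set1P->; rewrite ffunE. Qed.

Lemma link_flip lit F W x b c s : sat lit F (W :\ x) s ->
  link lit F W (glue [set x] [ffun=> b] s) (glue [set x] [ffun=> c] s).
Proof.
move=> ss; apply: (link_agree (A := W :\ x)); first exact: subsetDl.
  by move=> z zW; rewrite !(@glue1_out _ _ _ W).
by rewrite (@eq_sat _ _ _ _ s) //; apply: glue1_out.
Qed.

(** * Critical formulas whose small subformulas have surplus two *)

Section Loose.
Variables (lit : I -> V -> bool -> bool) (F : {set I}) (W : {set V}).
Hypothesis IH : rich_below #|F|.
Hypothesis crit : critical lit F W.
Hypothesis nconn : ~~ conn lit F W.
Hypothesis loose : forall Q, Q \subset F -> Q != set0 -> #|Q| + 2 <= #|F| ->
  #|Q| + 2 <= #|vars lit Q W|.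

Let hall_unfixed x b : #|unfixed lit F x b| + 2 <= #|F| ->
  hall lit 1 (unfixed lit F x b) (W :\ x).
Proof.
move=> le Q sQ nz; have := subset_leq_card sQ.
have := loose (subset_trans sQ (unfixed_sub _ _ _ _)) nz.
have := vars_D1 lit Q W x; nlia.
Qed.

Let half x s t : x \in W -> s x = t x -> sat lit F W s -> sat lit F W t ->
  #|unfixed lit F x (s x)| + 2 <= #|F| -> connect (link lit F W) s t.
Proof.
by move=> xW st ss tt /hall_unfixed/hall1_conn; apply: half_connect.
Qed.

(** If the literal were absent, [x] could be flipped to the other value in every solution, and the
    clauses then left open, which avoid [x] altogether, have a connected set of solutions. *)
Lemma loose_occurs x b : x \in vars lit F W -> exists2 i, i \in F & lit i x b.
Proof.
move=> xF; apply/exists_inP; apply: contraT => /exists_inPn no.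
have xW := subsetP (vars_sub _ _ _) _ xF.
case/varsP: (xF) => j [c [_ jF l]].
have bc : ~~ b = c by move: (no j jF); case: b c l {no} => [] [] //= ->.
have pr := unfixed_proper jF l; have ltU := proper_card pr.
have cU : conn lit (unfixed lit F x c) (W :\ x).
  have [->|Unz] := eqVneq (unfixed lit F x c) set0; first exact: conn0.
  apply: hall1_conn; apply: hall_unfixed; have := crit.2 _ pr Unz.
  have: vars lit (unfixed lit F x c) W \subset vars lit F W :\ x.
    apply/subsetP=> y /varsP[i [d [yW]]]; rewrite inFE => /andP[iF ni li].
    rewrite in_setD1 (varsE yW iF li) andbT; apply: contraNneq ni => yx.
    move: li; rewrite yx; case: (eqVneq d c) => [->|dc] //.
    have -> : d = b by move: dc; rewrite -bc; case: (b) (d) => [] [].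
    by rewrite (negPf (no i iF)).
  move/subset_leq_card; have := cardsD1 x (vars lit F W); rewrite xF -crit.1; nlia.
case/negP: nconn.
apply: (@conn_via _ _ _ (fun s => sat lit F W s /\ s x = c)) => [s ss|s t]; last first.
  by case=> ss sx [tt tx]; apply: (@half_connect _ _ _ x) => //; rewrite ?sx ?tx.
have [sx|sx] := eqVneq (s x) c; first by exists s.
have ssx : sat lit F (W :\ x) s.
  apply/satP=> k kF; case/satcP: (satP _ _ _ _ ss k kF) => z zW lz.
  apply/satcP; exists z => //; rewrite !inFE zW andbT.
  apply: contraTneq lz => ->; have -> : s x = b; last exact: no.
  by move: sx; rewrite -bc; case: (s x) (b) => [] [].
have lk := link_flip (s x) c ssx; rewrite glue1_id in lk.
exists (glue [set x] [ffun=> c] s); last exact: connect1.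
by split; [apply: link_satr lk | apply: glue1].
Qed.

Let other_lit i y : 1 < #|F| -> i \in F ->
  exists x b, [/\ x \in W, x != y & lit i x b].
Proof.
move=> F1 iF; have := crit.2 [set i]; rewrite properEcard sub1set iF cards1 F1.
rewrite -card_gt0 cards1 => /(_ isT isT) v1.
have [|j [x [b [/set1P-> xW l]]]] := @has_lit lit [set i] (W :\ y).
  by have := vars_D1 lit [set i] W y; nlia.
by exists x, b; move: xW; rewrite !inFE => /andP[].
Qed.

Lemma loose_unique i : 1 < #|F| -> i \in F ->
  exists x b, x \in W /\ unique lit F i x b.
Proof.
move=> F1 iF; suff /existsP[x /existsP[b /andP[xW u]]] :
    [exists x, exists b, (x \in W) && unique lit F i x b] by exists x, b.
apply: contraT => /existsPn none.
have nonuni x b : x \in W -> lit i x b -> ~~ unique lit F i x b.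
  by move=> xW _; have /existsPn/(_ b) := none x; rewrite xW.
have nonuniC x b : x \in W -> lit i x b -> #|unfixed lit F x b| + 2 <= #|F|.
  by move=> xW l; apply: nonunique_card (nonuni x b xW l).
have [x0 _] : exists x, x \in W.
  have /card_gt0P[x xF] : 0 < #|vars lit F W| by rewrite -crit.1; nlia.
  by exists x; apply: (subsetP (vars_sub _ _ _) _ xF).
have [y [b [yW _ ly]]] := other_lit x0 F1 iF.
have yb := hall1_conn (hall_unfixed (nonuniC y b yW ly)).
case/negP: nconn.
pose P s := sat lit F W s /\ s y = b.
have cP s t : P s -> P t -> connect (link lit F W) s t.
  by case=> ss sx [tt tx]; apply: (@half_connect _ _ _ y) => //; rewrite ?sx ?tx.
case: (boolP (conn lit (unfixed lit F y (~~ b)) (W :\ y))) => ynb.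
  have [w [c [wW wy lw]]] := other_lit y F1 iF.
  have [||s0 ss0 _] := @hall_sat_fix lit F (W :\ y) w c.
  - by rewrite !inFE wy.
  - move=> Q sQ nz; have := subset_leq_card sQ.
    have := loose (subset_trans sQ (unfixed_sub _ _ _ _)) nz.
    have := nonuniC w c wW lw.
    have := vars_D1 lit Q W y; have := vars_D1 lit Q (W :\ y) w; nlia.
  have lk := link_flip (~~ b) b ss0.
  apply: (@conn_via _ _ _ P) => // s ss.
  have [sy|sy] := eqVneq (s y) b; first by exists s.
  exists (glue [set y] [ffun=> b] s0).
    by split; [apply: link_satr lk | apply: glue1].
  apply: connect_trans (connect1 lk).
  have sy' : s y = ~~ b by move: sy; case: (s y) (b) => [] [].
  apply: (@half_connect _ _ _ y) => //; rewrite ?sy' ?glue1 //.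
  exact: link_satl lk.
have yF : y \in vars lit F W by apply: varsE iF ly.
have [c cF lc] := loose_occurs (~~ b) yF.
have pr := unfixed_proper cF lc; have ltU := proper_card pr.
have geU : #|F| < #|unfixed lit F y (~~ b)| + 2.
  by rewrite ltnNge; apply: contra ynb => /hall_unfixed/hall1_conn.
(* The value [~~ b] satisfies the single clause [c]; with two clauses gone this half would be
   connected. *)
have UE : unfixed lit F y (~~ b) = F :\ c.
  apply/eqP; rewrite eqEcard; apply/andP; split.
    apply/subsetP=> k; rewrite !inFE => /andP[-> nk]; rewrite andbT.
    by apply: contraNneq nk => ->.
  by have := cardsD1 c F; rewrite cF; nlia.
have ci : c != i.
  by apply: contraTneq lc => ->; apply/negP=> /(nonuniC _ _ yW); nlia.
have cFc : #|F| = #|F :\ c|.+1 by rewrite (cardsD1 c F) cF.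
rewrite UE in ynb.
have iFc : i \in F :\ c by rewrite !inFE eq_sym ci.
have critU : critical lit (F :\ c) (W :\ y).
  split; last first.
    move=> Q prQ nz; have := proper_card prQ.
    have := loose (subset_trans (proper_sub prQ) (subsetDl _ _)) nz.
    have := vars_D1 lit Q W y; nlia.
  have: F :\ c != set0 by apply/set0Pn; exists i.
  move/(crit.2 _ (properD1 cF)); have := vars_D1 lit (F :\ c) W y.
  have: vars lit (F :\ c) (W :\ y) \subset vars lit F W :\ y.
    apply/subsetP=> x /varsP[k [d [xW kF lk]]]; move: xW kF.
    rewrite !inFE => /andP[-> xW] /andP[_ kF]; exact: varsE xW kF lk.
  move/subset_leq_card; have := cardsD1 y (vars lit F W); rewrite yF -crit.1.
  by nlia.
have [|_ richU] := IH _ critU ynb; first by nlia.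
apply: (@conn_via _ _ _ P) => // s ss.
have [sy|sy] := eqVneq (s y) b; first by exists s.
have sy' : s y = ~~ b by move: sy; case: (s y) (b) => [] [].
have UE' : unsatc lit F [set y] s = F :\ c.
  by rewrite -UE -sy'; apply/setP=> k; rewrite !inFE satc_set1.
have ssU : sat lit (F :\ c) (W :\ y) s by rewrite -UE'; apply: unsatc_sat.
have [t st [x xW ux]] := richU i s iFc ssU.
have stF : connect (link lit F W) s (glue [set y] [ffun=> s y] t).
  have -> : glue [set y] [ffun=> s y] t = glue [set y] s t.
    by apply/ffunP=> z; rewrite !(glueE, ffunE) inFE; case: eqP => // ->.
  rewrite -{1}(glue_id [set y] s); apply: connect_glue_out; rewrite ?sub1set //.
  by rewrite UE'.
have ttU := connect_sat st ssU.
(* A literal of [i] unique in [F :\ c] but shared in [F] belongs to [c]. Thus [t] satisfies [c]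
   without [y], and [y] can be flipped into the connected half. *)
have tt : sat lit F (W :\ y) t.
  apply/satP=> k kF; have [kc|kc] := eqVneq k c; last first.
    by apply: (satP _ _ _ _ ttU); rewrite !inFE kc.
  have [lx uq] := uniqueP _ _ _ _ _ ux.
  have xW' : x \in W by move: xW; rewrite inFE => /andP[].
  have [j [jF ji lj]] := nonuniqueP lx (nonuni _ _ xW' lx).
  apply/satcP; exists x => //; rewrite kc; suff <- : j = c by [].
  apply/eqP; apply: contraNT ji => jc; apply/eqP; apply: uq => //.
  by rewrite !inFE jc.
exists (glue [set y] [ffun=> b] t).
  split; last exact: glue1.
  exact: link_satr (link_flip (s y) b tt).
exact: connect_trans stF (connect1 (link_flip (s y) b tt)).
Qed.

(** The surplus left after fixing [w] both connects this half and pays for prescribing [u]. *)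
Let jump s w (u : V) c : w \in W -> u \in W -> u != w -> sat lit F W s ->
  #|unfixed lit F w (s w)| + 2 <= #|F| ->
  exists t, [/\ connect (link lit F W) s t, sat lit F W t & t u = c].
Proof.
move=> wW uW uw ss le.
have [|t tt tu] := hall1_sat_fix c _ (hall_unfixed le) (x := u).
  by rewrite !inFE uw.
exists (glue [set w] [ffun=> s w] t).
have sg := fix_sat wW tt; split=> //; last by rewrite !(glueE, ffunE) inFE (negPf uw).
by apply: half wW _ ss sg le; rewrite glue1.
Qed.

Lemma rich_loose : rich lit F W.
Proof.
split=> [|i s iF ss]; first exact: loose_occurs.
case/satcP: (satP _ _ _ _ ss i iF) => w wW lw.
case: (boolP (unique lit F i w (s w))) => [uw|nuw].
  by exists s => //; exists w.
have lew := nonunique_card iF lw nuw.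
have F1 : 1 < #|F| by nlia.
have [u [c [uW uu]]] := loose_unique F1 iF.
have [uw|uw] := eqVneq u w; last first.
  have [t [st _ tu]] := jump c wW uW uw ss lew.
  by exists t => //; exists u; rewrite ?tu.
(* The unique literal is the opposite one of [w] itself, so [w] is first released by moving to
   another literal of [i]. *)
have [v [d [vW vw lv]]] := other_lit w F1 iF.
have [t [st tt tv]] := jump d wW vW vw ss lew.
case: (boolP (unique lit F i v d)) => [uv|nuv].
  by exists t => //; exists v; rewrite ?tv.
have lev := nonunique_card iF lv nuv.
have [||t' [st' _ tu']] := @jump t v u c vW uW _ tt.
- by rewrite uw eq_sym.
- by rewrite tv.
by exists t'; [apply: connect_trans st' | exists u; rewrite ?tu'].
Qed.

End Loose.

(* The new variable z tells which of r1 and r2 is satisfied by a literal on the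
   variables that z replaces. *)
Definition split_lit lit z r1 r2 i x b :=
  if x == z then i == (if b then r1 else r2) else lit i x b.

(** * Critical formulas with a subformula of surplus one *)

Section Tight.
Variables (lit : I -> V -> bool -> bool) (F Q : {set I}) (W : {set V}).
Hypothesis IH : rich_below #|F|.
Hypothesis crit : critical lit F W.
Hypothesis nconn : ~~ conn lit F W.
Hypothesis QF : Q \subset F.
Hypothesis Qnz : Q != set0.
Hypothesis tQ : #|vars lit Q W| = #|Q|.+1.
Hypothesis leQ : #|Q| + 2 <= #|F|.
Hypothesis maxQ : forall Q', Q' \subset F -> Q' != set0 ->
  #|vars lit Q' W| = #|Q'|.+1 -> #|Q'| + 2 <= #|F| -> #|Q'| <= #|Q|.

Let D := vars lit Q W.
Let R := F :\: Q.
Let O := W :\: D.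

Let DW : D \subset W. Proof. exact: vars_sub. Qed.
Let OW : O \subset W. Proof. exact: subsetDl. Qed.

Let cR : #|F| = #|Q| + #|R|. Proof. exact: cards_rest. Qed.

Let Q0 : 0 < #|Q|. Proof. by rewrite card_gt0. Qed.

Let cO : #|R| = #|vars lit R O|.+1.
Proof.
have := vars_card_split lit Q R W; rewrite setUDK // -crit.1 tQ -/D -/O.
by have := cR; nlia.
Qed.

(** The strict inequality is where maximality of [Q] enters: equality would make [Q :|: R'] a larger
    subformula of surplus one. *)
Let surR R' : R' \subset R -> R' != set0 ->
  (R' != R -> #|R'| <= #|vars lit R' O|) /\
  (#|R'| + 2 <= #|R| -> #|R'| < #|vars lit R' O|).
Proof.
move=> sR nz; have sQR := subU_rest QF sR.
have c1 := vars_card_split lit Q R' W; have c2 := cardsU_rest sR.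
have nz' : Q :|: R' != set0 by rewrite setU_eq0 (negPf Qnz).
rewrite tQ -/D -/O in c1.
have surp : R' != R -> #|R'| <= #|vars lit R' O|.
  move=> ne; have := crit.2 (Q :|: R'); rewrite properEcard sQR cR c2 nz'.
  by rewrite ltn_add2l proper_card ?properEneq ?ne // => /(_ isT isT); nlia.
split=> // le; have ne : R' != R by apply: contraTneq le => ->; nlia.
have := surp ne; rewrite leq_eqVlt => /orP[/eqP e|//].
have := maxQ sQR nz'; have := nz; rewrite -card_gt0; have := cR; nlia.
Qed.

Let hallR R' : R' \proper R -> hall lit 0 R' O.
Proof.
move=> pr R1 sR nz; rewrite addn0; apply: (surR _ nz).1.
  exact: subset_trans sR (proper_sub pr).
by apply: contraTneq pr => <-; rewrite properE sR andbF.
Qed.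

Let hallR2 R' : R' \subset R -> #|R'| + 2 <= #|R| -> hall lit 1 R' O.
Proof.
move=> sR le R1 sR1 nz; have := subset_leq_card sR1 => ?.
by rewrite addn1; apply: (surR (subset_trans sR1 sR) nz).2; nlia.
Qed.

Let cRD r : r \in R -> #|R| = #|R :\ r|.+1.
Proof. by move=> rR; rewrite (cardsD1 r R) rR. Qed.

Let satR1 r : r \in R -> exists s, sat lit (R :\ r) O s.
Proof. by move=> rR; apply: hall_sat (hallR _); apply: properD1. Qed.

Let varsR1 r : r \in R -> vars lit (R :\ r) O = vars lit R O.
Proof.
move=> rR; apply/eqP; rewrite eqEcard varsS ?subsetDl //.
have c := cRD rR; have := (@surR (R :\ r) (subsetDl _ _) _).1.
rewrite -card_gt0 => h; have := h _ _; have := cO.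
by have := properD1 rR; rewrite properEneq => /andP[-> _]; have := leQ;
  have := cR; move=> c1 le1 c2 /(_ _ isT); nlia.
Qed.

Let critR r : r \in R -> critical lit (R :\ r) O.
Proof.
move=> rR; have c := cRD rR; split; first by rewrite varsR1 //; have := cO; nlia.
move=> R' pr nz; have := proper_card pr => lt.
apply: (surR (subset_trans (proper_sub pr) (subsetDl _ _)) nz).2; nlia.
Qed.

Let hQ : hall lit 1 Q D.
Proof.
apply: hall_vars DW (subxx _) _ => Q' sQ nz; rewrite addn1; apply: crit.2 => //.
by apply: sub_proper_trans sQ _; rewrite properEcard QF; have := leQ; nlia.
Qed.

Let cQ : conn lit Q D. Proof. exact: hall1_conn. Qed.

Let satQ s : sat lit F W s -> sat lit Q D s.
Proof. by move=> ss; apply: sat_vars; apply: satS ss. Qed.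

Let hasD r := [exists x in D, exists b, lit r x b].

Let satc_hasD r s : satc lit r D s -> hasD r.
Proof.
case/satcP=> x xD l; apply/exists_inP; exists x => //.
by apply/existsP; exists (s x).
Qed.

Let hasD_sat r : hasD r -> exists2 s, sat lit Q D s & satc lit r D s.
Proof.
case/exists_inP=> x xD /existsP[b l].
have [s ss sx] := hall1_sat_fix b xD hQ; exists s => //.
by apply/satcP; exists x; rewrite ?sx.
Qed.

(** Otherwise the clauses of [R :\ r] would have all their variables among those of [R] in [O], too
    few for a critical formula. *)
Let other_hasD r : r \in R -> exists r', [/\ r' \in R, r' != r & hasD r'].
Proof.
move=> rR; have c := cRD rR.
have [|] := boolP [exists r' in R :\ r, hasD r'].
  by case/exists_inP=> r'; rewrite !inFE => /andP[r'r r'R] h; exists r'; rewrite inFE.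
move/exists_inPn=> no; have := crit.2 (R :\ r); rewrite -card_gt0.
have: vars lit (R :\ r) W \subset vars lit R O.
  apply/subsetP=> x /varsP[i [b [xW iR l]]].
  apply: (varsE _ _ l); last by move: iR; rewrite inFE => /andP[].
  rewrite inFE xW andbT; apply: contra (no i iR) => xD.
  by apply/exists_inP; exists x => //; apply/existsP; exists b.
move/subset_leq_card; have := cO; have := leQ; have := cR.
have: R :\ r \subset F by rewrite (subset_trans (subsetDl _ _)) ?subsetDl.
by rewrite properEcard => -> /=; nlia.
Qed.

Let notsatR s : sat lit F W s -> (forall r, r \in R -> ~~ satc lit r D s) ->
  sat lit R O s.
Proof.
move=> ss no; apply/satP=> r rR; have rF : r \in F by move: rR; rewrite inFE => /andP[].
by have := sat_split D ss rF; rewrite (negPf (no r rR)).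
Qed.

(** Two clauses of [R] satisfied on [D] are what it takes for the remaining ones to have surplus one
    off [D]. *)
Let fiber2 s t r r' : {in D, s =1 t} -> sat lit F W s -> sat lit F W t ->
  r \in R -> r' \in R -> r' != r -> satc lit r D s -> satc lit r' D s ->
  connect (link lit F W) s t.
Proof.
move=> st ss tt rR r'R ne sr sr'; apply: (fiber_connect DW st ss tt _).
have sub : unsatc lit F D s \subset R :\ r :\ r'.
  apply/subsetP=> k kU; have := subsetP (unsatc_rest F (satQ ss)) _ kU.
  move: kU; rewrite !inFE => /andP[kF nk] ->; rewrite andbT.
  by apply/andP; split; apply: contraNneq nk => ->.
apply: hall1_conn; apply: hallR2.
  by apply: subset_trans sub _; rewrite (subset_trans (subsetDl _ _)) ?subsetDl.
have := subset_leq_card sub; have := cRD rR.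
by have := cardsD1 r' (R :\ r); rewrite in_setD1 ne r'R /=; nlia.
Qed.

(** Leads to a solution of the merged formula: if no clause of [R] is satisfied on [D], the outside
    satisfies them all and the inside may slide. *)
Let has_r s : sat lit F W s ->
  exists2 t, connect (link lit F W) s t & exists2 r, r \in R & satc lit r D t.
Proof.
move=> ss; have [/exists_inP h|/exists_inPn no] :=
  boolP [exists r in R, satc lit r D s]; first by exists s.
have sO := notsatR ss no.
have [r0 r0R] : exists r, r \in R by apply/card_gt0P; rewrite cO.
have [r [rR _ /hasD_sat[t tQ' tr]]] := other_hasD r0R.
exists (glue D t s); last by exists r; rewrite ?satc_glue_in.
rewrite -{1}(glue_id D s); apply: connect_slide sO _ tQ' => //; exact: satQ.
Qed.

(** * The merged formula on [D] *)

Variable r0 : I.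
Hypothesis r0R : r0 \in R.
Let lit1 := merge lit R r0.
Let F1 := r0 |: Q.

Let cF1 : #|F1| = #|Q|.+1. Proof. exact: merge_card r0R. Qed.

Let varsF1 : vars lit1 F1 D = D.
Proof.
apply/eqP; rewrite eqEsubset vars_sub /=.
rewrite /lit1 /F1 merge_varsU // setUDK //; apply/subsetP=> x /varsP[i [b [xW iQ l]]].
exact: varsE (varsE xW iQ l) (subsetP QF _ iQ) l.
Qed.

Lemma tight_crit1 : critical lit1 F1 D.
Proof.
split=> [|Q' pr nz]; first by rewrite varsF1 cF1 -tQ.
have [r0Q'|r0Q'] := boolP (r0 \in Q'); last first.
  have sQ : Q' \subset Q.
    apply/subsetP=> i iQ'; have /setU1P[e|//] := subsetP (proper_sub pr) _ iQ'.
    by rewrite -e iQ' in r0Q'.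
  rewrite /lit1 (merge_varsQ _ _ r0R) // (vars_in (W := W)) ?varsS //.
  apply: crit.2 => //; rewrite properEcard (subset_trans sQ QF).
  by have := subset_leq_card sQ; have := leQ; nlia.
rewrite -(setD1K r0Q') in pr *; set Q'' := Q' :\ r0 in pr *.
have r0Q'' : r0 \notin Q'' by rewrite !inFE eqxx.
have sQ : Q'' \subset Q.
  apply/subsetP=> i iQ'; have /setU1P[e|//] := subsetP (proper_sub pr) _ (setU1r _ iQ').
  by rewrite -e iQ' in r0Q''.
have ltQ : #|Q''| < #|Q|.
  by have := proper_card pr; rewrite cF1 cardsU1 r0Q''; nlia.
rewrite cardsU1 r0Q'' /lit1 merge_varsU // -/R.
have dQ : R \subset F :\: Q'' by apply: setDS.
have c1 := cardsU_rest dQ.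
have sF : Q'' :|: R \subset F by apply: subU_rest dQ; apply: subset_trans sQ QF.
(* The variables of [Q'' :|: R] outside [D] are one fewer than the clauses of [R], so the rest of
   the surplus lies in [D]. *)
have := crit.2 (Q'' :|: R); rewrite properEcard sF c1 cR ltn_add2r ltQ.
rewrite setU_eq0 -[R == _]cards_eq0 cO andbF => /(_ isT isT).
have: vars lit (Q'' :|: R) W \subset vars lit (Q'' :|: R) D :|: vars lit R O.
  apply/subsetP=> x /varsP[i [b [xW iQR l]]]; apply/setUP.
  have [xD|xD] := boolP (x \in D); [left|right]; first exact: varsE l.
  case/setUP: iQR => [iQ|iR]; last by apply: varsE iR l; rewrite inFE xD.
  by case/negP: xD; apply: varsE l => //; apply: (subsetP sQ).
move/subset_leq_card; rewrite cardsU; have := cO; nlia.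
Qed.

Let sat1 s r : sat lit F W s -> r \in R -> satc lit r D s -> sat lit1 F1 D s.
Proof. by move=> ss rR sr; apply/merge_sat=> //; split; [apply: satQ|exists r]. Qed.

Let link1P s t : link lit1 F1 D s t ->
  [/\ sat lit Q D s, sat lit Q D t, link lit Q D s t
    & exists r, [/\ r \in R, satc lit r D s, satc lit r D t
                & satc lit r [set x in D | s x == t x] s]].
Proof.
move=> lk; have /(merge_sat _ _ _ r0R)[sQ _] := link_satl lk.
have /(merge_sat _ _ _ r0R)[tQ' _] := link_satr lk.
have /(merge_sat _ _ _ r0R)[lQ [r rR sr]] := etrans (esym (linkE _ _ _ _ _)) lk.
split=> //; first by rewrite linkE.
exists r; split=> //.
  by apply: satcS sr; apply/subsetP=> x; rewrite inFE => /andP[].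
case/satcP: sr => x; rewrite inFE => /andP[xD /eqP e] l.
by apply/satcP; exists x; rewrite -?e.
Qed.

(** The values of [s] outside [D] may fail a clause of [R] other than the clause [r] kept by the
    link. Then [s] satisfies that second clause on [D], and [fiber2] allows the outside to be
    replaced. *)
Let lift1 s t t' : sat lit F W s -> {in D, s =1 t} -> link lit1 F1 D t t' ->
  exists2 s', connect (link lit F W) s s' & {in D, s' =1 t'}.
Proof.
move=> ss st lk; have [tQ' tQ'' lkQ [r [rR sr _ ar]]] := link1P lk.
have lkQ' := etrans (esym (linkE _ _ _ _ _)) lkQ.
have gs u : {in D, glue D t' u =1 t'} by apply: glue_in.
have direct u : sat lit (R :\ r) O u ->
    link lit F W (glue D t u) (glue D t' u).
  move=> uR; apply: link_glue => // i iF.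
  have [->|ir] := eqVneq i r; first by rewrite ar.
  have [iQ|iQ] := boolP (i \in Q); first by rewrite (satP _ _ _ _ lkQ').
  apply/orP; right; apply: satcS (satP _ _ _ _ uR i _); last by rewrite !inFE ir iQ.
  by apply/subsetP=> x xO; rewrite inFE xO /=.
have [sR|sR] := boolP (sat lit (R :\ r) O s).
  exists (glue D t' s); last exact: gs.
  rewrite -{1}(glue_agree (s := t) (t := s) (D := D)); first exact/connect1/direct.
  by move=> x /st.
have [r1 r1R nr1] : exists2 r1, r1 \in R :\ r & ~~ satc lit r1 O s.
  exact/satPn.
have [r1r r1R'] : r1 != r /\ r1 \in R by move: r1R; rewrite !inFE => /andP[].
have sr1 : satc lit r1 D s.
  have r1F : r1 \in F by move: r1R'; rewrite inFE => /andP[].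
  by have := sat_split D ss r1F; rewrite (negPf nr1) orbF.
have [w wR] := satR1 rR; exists (glue D t' w); last exact: gs.
apply: connect_trans (connect1 (direct w wR)).
have sw := link_satl (direct w wR).
apply: fiber2 ss sw rR r1R' r1r _ sr1.
  by move=> x xD; rewrite glue_in // st.
by rewrite (eq_satc _ _ st).
Qed.

Let lift s t : sat lit F W s -> connect (link lit1 F1 D) s t ->
  exists2 s', connect (link lit F W) s s' & {in D, s' =1 t}.
Proof.
move=> ss; move: t; apply: connect_ind => [|u v _ [s' ss' s'u] uv]; first by exists s.
have [s'' s's'' s''v] := lift1 (connect_sat ss' ss) s'u uv.
by exists s'' => //; apply: connect_trans s's''.
Qed.

(** Were it connected, every solution could be carried over some [t] satisfying two clauses of [R]
    on [D], where the fiber is connected by [fiber2]. Such a [t] lies on a path from a solution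
    satisfying [r1] to one satisfying [r2], since each link keeps some clause of [R] satisfied. *)
Lemma tight_nconn1 : ~~ conn lit1 F1 D.
Proof.
apply: contra nconn => /connP c1.
have [r1 [r1R _ h1]] := other_hasD r0R.
have [r2 [r2R r21 h2]] := other_hasD r1R.
have [s1 s1Q s1r] := hasD_sat h1; have [s2 s2Q s2r] := hasD_sat h2.
have [t [tQ' tr1 [r [rR rr1 tr]]]] : exists t,
    [/\ sat lit1 F1 D t, satc lit r1 D t
      & exists r, [/\ r \in R, r != r1 & satc lit r D t]].
  have m1 : sat lit1 F1 D s1 by apply/merge_sat=> //; split=> //; exists r1.
  have m2 : sat lit1 F1 D s2 by apply/merge_sat=> //; split=> //; exists r2.
  have := c1 _ _ m1 m2; pose P u := (exists t,
    [/\ sat lit1 F1 D t, satc lit r1 D t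
      & exists r, [/\ r \in R, r != r1 & satc lit r D t]]) \/ satc lit r1 D u.
  move=> c12; have [//|s2r1] : P s2; last by exists s2; split=> //; exists r2.
  apply: connect_ind c12; first by right.
  move=> y z _ [|yr1] lk; first by left.
  have [_ _ _ [r [rR yr zr _]]] := link1P lk.
  have [rr1|rr1] := eqVneq r r1; first by right; rewrite -rr1.
  by left; exists y; split; [apply: link_satl lk| |exists r].
apply: (@conn_via _ _ _ (fun s => sat lit F W s /\ {in D, s =1 t})) => [s ss|s s'].
  have [s' ss' [r' r'R s'r']] := has_r ss; have s'F := connect_sat ss' ss.
  have [s'' s's'' s''t] := lift s'F (c1 _ _ (sat1 s'F r'R s'r') tQ').
  exists s''; last exact: connect_trans s's''.
  by split=> //; apply: connect_sat s'F.
case=> ss st [ss' st']; apply: fiber2 r1R rR rr1 _ _ => //.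
- by move=> x xD; rewrite st ?st'.
- by rewrite (eq_satc _ _ st).
- by rewrite (eq_satc _ _ st).
Qed.

Let rich1 : rich lit1 F1 D.
Proof. by apply: IH tight_crit1 tight_nconn1; rewrite cF1; have := leQ; nlia. Qed.

Lemma tight_occursD x b : x \in D -> exists2 i, i \in F & lit i x b.
Proof.
rewrite -varsF1 => /(rich1.1 _ b)[i /setU1P[->|iQ]].
  by case/mergeR=> r; rewrite inFE => /andP[_ rF] l; exists r.
by rewrite /lit1 (mergeQ _ _ _ r0R iQ) => l; exists i => //; apply: (subsetP QF).
Qed.

Lemma tight_uniqueQ i s : i \in Q -> sat lit F W s ->
  exists2 t, connect (link lit F W) s t &
  exists2 x, x \in W & unique lit F i x (t x).
Proof.
move=> iQ ss; have [s' ss' [r rR s'r]] := has_r ss.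
have s'F := connect_sat ss' ss.
have [t st [x xD u]] := rich1.2 _ _ (setU1r r0 iQ) (sat1 s'F rR s'r).
have [s'' ss'' s''t] := lift s'F st; exists s''.
  exact: connect_trans ss' ss''.
exists x; first exact: (subsetP DW).
by rewrite s''t //; apply: merge_uniqueQ u.
Qed.

(** A literal unique to [r0] is absent from [Q] but may be shared within [R]; telling the clauses of
    [R] apart is the remaining difficulty. *)
Let lift_uniqueR s : sat lit F W s -> (exists2 r, r \in R & satc lit r D s) ->
  exists t, [/\ connect (link lit1 F1 D) s t,
    exists2 s', connect (link lit F W) s s' & {in D, s' =1 t}
    & exists x, [/\ x \in D, exists2 r, r \in R & lit r x (t x)
                & forall j, j \in Q -> ~~ lit j x (t x)]].
Proof.
move=> ss [r rR sr].
have [t st [x xD u]] := rich1.2 _ _ (setU11 r0 Q) (sat1 ss rR sr).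
by exists t; split=> //; [apply: lift | exists x; case: (merge_uniqueR r0R u)].
Qed.

(** * The remaining clauses cannot all be satisfied off [D] *)

Section RestUnsat.
Hypothesis unsatR : forall s, ~~ sat lit R O s.

Let uniqO x b i j : x \in O -> i \in R -> j \in R -> lit i x b -> lit j x b ->
  i = j.
Proof.
move=> xO iR jR li lj; apply/eqP; apply: contraT => ij.
have le := unfixed_card iR jR ij li lj.
have [|s ss _] := @hall_sat_fix lit R O x b xO; last by case/negP: (unsatR s).
exact: hall_D1 (hallR2 (unfixed_sub _ _ _ _) le).
Qed.

(** A disconnected critical formula contains both literals of its variables, but by [uniqO] a
    literal of [r] on [O] does not occur in [R :\ r]. *)
Let connR r : r \in R -> conn lit (R :\ r) O.
Proof.
move=> rR; apply: contraT => /(IH _ (critR rR)) h; have {h} [|occ _] := h.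
  by have := cRD rR; have := cR; nlia.
have [|j [x [b [/set1P-> xO l]]]] := @has_lit lit [set r] O.
  have := (@surR [set r] _ _).1; rewrite sub1set rR cards1 -card_gt0 cards1.
  by apply=> //; apply/negP=> /eqP e; have := leQ; have := cR; rewrite -e cards1; nlia.
have [|k] := occ x b; first by rewrite varsR1 //; apply: varsE l.
rewrite in_setD1 => /andP[kr kR] lk; case/eqP: kr.
exact: uniqO xO kR rR lk l.
Qed.

Let fiber1 s t r : {in D, s =1 t} -> sat lit F W s -> sat lit F W t ->
  r \in R -> satc lit r D s -> connect (link lit F W) s t.
Proof.
move=> st ss tt rR sr; apply: (fiber_connect DW st ss tt _).
have sub : unsatc lit F D s \subset R :\ r.
  apply/subsetP=> k kU; have := subsetP (unsatc_rest F (satQ ss)) _ kU.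
  move: kU; rewrite !inFE => /andP[kF nk] ->; rewrite andbT.
  by apply: contraNneq nk => ->.
have := sub; rewrite subEproper => /orP[/eqP->|pr]; first exact: connR.
apply: hall1_conn; apply: hallR2; first exact: subset_trans sub (subsetDl _ _).
by have := proper_card pr; have := cRD rR; nlia.
Qed.

Lemma unsatR_occurs x b : x \in O -> x \in vars lit R O ->
  exists2 i, i \in F & lit i x b.
Proof.
move=> xO xR; suff [i iR l] : exists2 i, i \in R & lit i x b.
  by exists i => //; move: iR; rewrite inFE => /andP[].
apply/exists_inP; apply: contraT => /exists_inPn no.
case/varsP: (xR) => r [c [_ rR l]].
have bc : c = ~~ b by move: (no r rR); case: b c l {no} => [] [] //= ->.
have [s ss] := satR1 rR; case/negP: (unsatR (glue [set x] [ffun=> c] s)).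
apply/satP=> i iR; have [->|ir] := eqVneq i r.
  by apply/satcP; exists x; rewrite // glue1.
have iR' : i \in R :\ r by rewrite in_setD1 ir.
case/satcP: (satP _ _ _ _ ss i iR') => y yO ly; apply/satcP.
exists y => //; rewrite !(glueE, ffunE) inFE; case: eqP => // yx.
move: ly; rewrite yx bc; case: (s x) (b) (no i iR) => [] [] //.
  by move=> /negP.
by move=> /negP.
Qed.

Lemma unsatR_unique i s : i \in R -> sat lit F W s ->
  exists2 t, connect (link lit F W) s t &
  exists2 x, x \in W & unique lit F i x (t x).
Proof.
move=> iR ss; have [s1 ss1 hr1] := has_r ss; have s1F := connect_sat ss1 ss.
have [t [_ [s2 s12 s2t] [x [xD [r rR l] noQ]]]] := lift_uniqueR s1F hr1.
have s2F := connect_sat s12 s1F.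
have ss2 := connect_trans ss1 s12.
have [/forall_inP un|/forall_inPn[j jR]] :=
    boolP [forall j in R, lit j x (t x) ==> (j == i)].
  exists s2 => //; exists x; first exact: (subsetP DW).
  have ri : r = i by apply/eqP; move/implyP: (un r rR); apply.
  rewrite s2t //; apply/uniqueP; split=> [|j jF lj]; first by rewrite -ri.
  apply/eqP; have [jQ|jQ] := boolP (j \in Q); first by rewrite (negPf (noQ j jQ)) in lj.
  by apply: (implyP (un j _)) lj; rewrite inFE jQ.
rewrite negb_imply => /andP[lj ji].
(* As [j] is satisfied on [D], the outside can be replaced by a solution of [R :\ j]; there [i] is
   satisfied by a literal on [O], unique by [uniqO]. *)
have [w wR] := satR1 jR.
have sj : satc lit j D s2 by apply/satcP; exists x; rewrite ?s2t.
have gF : sat lit F W (glue D s2 w).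
  apply: sat_glue => // k kF; have [kQ|kQ] := boolP (k \in Q).
    by rewrite (satP _ _ _ _ (satQ s2F)).
  have [->|kj] := eqVneq k j; first by rewrite sj.
  by rewrite (satP _ _ _ _ wR) ?orbT // !inFE kj kQ.
have iR' : i \in R :\ j by rewrite in_setD1 eq_sym ji.
case/satcP: (satP _ _ _ _ wR i iR') => y yO ly.
exists (glue D s2 w).
  apply: connect_trans ss2 _; apply: fiber1 s2F gF jR sj.
  by move=> z zD; rewrite glue_in.
exists y; first exact: (subsetP OW).
rewrite (glue_out _ _ yO); apply: unique_rest (yO) _.
by apply/uniqueP; split=> // k kR lk; apply: uniqO lk ly.
Qed.

End RestUnsat.

(** * The remaining clauses can be satisfied off [D] *)

Section RestSat.
Variables rho s0 : {ffun V -> bool}.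
Hypothesis rhoR : sat lit R O rho.
Hypothesis s0Q : sat lit Q D s0.
(* By inK2 below, every solution satisfying two clauses of R by literals on D
   lies in the component of rho. *)
Let inK s := connect (link lit F W) s (glue D s0 rho).

Let inK_rho t : sat lit Q D t -> inK (glue D t rho).
Proof. by move=> tQ'; apply: connect_slide rhoR tQ' s0Q. Qed.

Let sat_rho t : sat lit Q D t -> sat lit F W (glue D t rho).
Proof. by move=> tQ'; apply: sat_glue2 rhoR. Qed.

Let inK2 s r r' : sat lit F W s -> r \in R -> r' \in R -> r' != r ->
  satc lit r D s -> satc lit r' D s -> inK s.
Proof.
move=> ss rR r'R ne sr sr'; apply: connect_trans (inK_rho (satQ ss)).
apply: (fiber2 _ ss (sat_rho (satQ ss)) rR r'R ne sr sr').
by move=> x xD; rewrite glue_in.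
Qed.

Let notK s t : connect (link lit F W) s t -> ~~ inK s -> ~~ inK t.
Proof. by move=> st; apply: contra; apply: connect_trans st. Qed.

Let satR_inO s i : sat lit F W s -> i \in R -> ~~ satc lit i D s ->
  satc lit i O s.
Proof.
move=> ss; rewrite inE => /andP[_ iF] ni.
by have := sat_split D ss iF; rewrite (negPf ni).
Qed.

Let outK : exists2 s, sat lit F W s & ~~ inK s.
Proof.
have [/existsP[s /andP[]]|/existsPn no] :=
  boolP [exists s, sat lit F W s && ~~ inK s]; first by exists s.
case/negP: nconn; apply: (@conn_via _ _ _ (fun s => s = glue D s0 rho)).
  move=> s ss; exists (glue D s0 rho) => //; have := no s.
  by rewrite ss /= negbK.
by move=> s t -> ->.
Qed.

(** Outside the component of [rho] no two clauses of [R] are satisfied on [D] at once. Links of the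
    merged formula keep one satisfied, so it stays [i], and the literal reached is shared with no
    other clause. *)
Let outK_unique s i : sat lit F W s -> ~~ inK s -> i \in R -> satc lit i D s ->
  exists2 s', connect (link lit F W) s s' &
  exists2 x, x \in D & unique lit F i x (s' x).
Proof.
move=> ss sK iR si.
have [|t [st [s' ss' s't] [x [xD [r rR l] noQ]]]] := lift_uniqueR ss.
  by exists i.
have only j u u' : connect (link lit F W) s u -> {in D, u =1 u'} -> j \in R ->
    satc lit j D u' -> satc lit i D u' -> j = i.
  move=> su uu' jR uj ui; apply/eqP; apply: contraT => ji.
  case/negP: (notK su sK).
  by apply: (inK2 (connect_sat su ss) iR jR ji); rewrite (eq_satc _ _ uu').
have ti : satc lit i D t.
  move: t st {s' ss' s't x xD r rR l noQ}; apply: connect_ind => // y z sy yi yz.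
  have [_ _ _ [r [rR yr zr _]]] := link1P yz.
  have [s' ss' s'y] := lift ss sy.
  by rewrite -(only r s' y).
exists s' => //; exists x => //; rewrite s't //.
have tl j : lit j x (t x) -> satc lit j D t by move=> lj; apply/satcP; exists x.
have ri : r = i by apply: (only r s' t) => //; apply: tl.
apply/uniqueP; split=> [|j jF lj]; first by rewrite -ri.
have [jQ|jQ] := boolP (j \in Q); first by rewrite (negPf (noQ j jQ)) in lj.
by apply: (only j s' t) => //; [rewrite inE jQ | apply: tl].
Qed.

(** * A new variable in place of [D] *)

Section Split.
Variables (z : V) (r1 r2 : I).
Hypothesis zD : z \in D.
Hypothesis r1R : r1 \in R.
Hypothesis r2R : r2 \in R.
Hypothesis r12 : r2 != r1.
Hypothesis h1 : hasD r1.
Hypothesis h2 : hasD r2.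

Let lit2 := split_lit lit z r1 r2.
(** Any element of [D] can name the new variable, being absent from [O]. *)
Let W2 := z |: O.
Let sel b := if b then r1 else r2.

Let selR b : sel b \in R. Proof. by case: b. Qed.

Let zO x : x \in O -> (x == z) = false.
Proof. by rewrite inE => /andP[xD _]; apply: contraNF xD => /eqP->. Qed.

Let satc2P i t :
  reflect (i = sel (t z) \/ satc lit i O t) (satc lit2 i W2 t).
Proof.
apply: (iffP (satcP _ _ _ _)) => [[x /setU1P[->|xO]]|[->|/satcP[x xO l]]].
- by rewrite /lit2 /split_lit eqxx => /eqP->; left.
- by rewrite /lit2 /split_lit zO // => l; right; apply/satcP; exists x.
- by exists z; rewrite ?setU11 // /lit2 /split_lit eqxx.
- by exists x; rewrite ?setU1r // /lit2 /split_lit zO.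
Qed.

Let vars2S R' : vars lit R' O \subset vars lit2 R' W2.
Proof.
apply/subsetP=> x /varsP[i [b [xO iR l]]]; apply/varsP; exists i, b.
by rewrite setU1r // /lit2 /split_lit zO.
Qed.

Let vars2z R' b : sel b \in R' -> #|vars lit R' O| < #|vars lit2 R' W2|.
Proof.
move=> bR; apply: proper_card; rewrite properE vars2S; apply/subsetPn; exists z.
  by apply/varsP; exists (sel b), b; rewrite setU11 /lit2 /split_lit !eqxx.
by apply/negP=> /(subsetP (vars_sub _ _ _)) /zO; rewrite eqxx.
Qed.

Let vars2R : #|vars lit2 R W2| = #|R|.
Proof.
have := vars2z (selR true); have := cO.
have: vars lit2 R W2 \subset z |: vars lit R O.
  apply/subsetP=> x /varsP[i [b [/setU1P[->|xO] iR l]]]; first exact: setU11.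
  by move: l; rewrite /lit2 /split_lit zO // => l; apply/setU1r/(varsE xO iR l).
move/subset_leq_card; rewrite cardsU1.
have -> : z \notin vars lit R O.
  by apply/negP=> /(subsetP (vars_sub _ _ _)) /zO; rewrite eqxx.
by move=> /= le1 e lt; nlia.
Qed.

(** A subformula containing [r1] or [r2] gains the variable [z]; one containing neither misses two
    clauses of [R] and has surplus one already. *)
Lemma split_crit : critical lit2 R W2.
Proof.
split=> // R' pr nz; have ltR := proper_card pr; have sR := proper_sub pr.
have [ge le] := surR sR nz.
have ne : R' != R by apply: contraTneq ltR => ->; rewrite ltnn.
have [le2|gt2] := leqP (#|R'| + 2) #|R|.
  exact: leq_trans (le le2) (subset_leq_card (vars2S R')).
apply: leq_ltn_trans (ge ne) _.
have [r1R'|r1R'] := boolP (r1 \in R'); first exact: (@vars2z _ true).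
have [r2R'|r2R'] := boolP (r2 \in R'); first exact: (@vars2z _ false).
have : R' \subset R :\ r1 :\ r2.
  apply/subsetP=> k kR; rewrite !in_setD1 (subsetP sR) // andbT.
  by apply/andP; split; [apply: contraNneq r2R' | apply: contraNneq r1R'] => <-.
move/subset_leq_card; have := cardsD1 r1 R; have := cardsD1 r2 (R :\ r1).
by rewrite in_setD1 r12 r1R r2R /=; nlia.
Qed.

Definition repr s t := {in O, s =1 t} /\ satc lit (sel (t z)) D s.

(** A link that flips [z] keeps all of [R] satisfied on [O], which frees the values on [D] to slide
    to a solution of [Q] satisfying the other selected clause. *)
Let lift2 s t t' : sat lit F W s -> repr s t -> link lit2 R W2 t t' ->
  exists2 s', connect (link lit F W) s s' & repr s' t'.
Proof.
move=> ss [st sz] /linkP lk.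
have glink (u v : {ffun V -> bool}) : sat lit Q D u ->
    (forall i, i \in R -> satc lit i D u
       || satc lit i [set x in O | v x == t' x] v) ->
    link lit F W (glue D u v) (glue D u t').
  move=> uQ uv; apply: link_glue => // i iF.
  have uu : satc lit i D u -> satc lit i [set x in D | u x == u x] u.
    by apply: satcS; apply/subsetP=> x xD; rewrite inE eqxx xD.
  have [iQ|iQ] := boolP (i \in Q); first by rewrite uu // (satP _ _ _ _ uQ).
  have iR : i \in R by rewrite inE iQ.
  by have /orP[/uu->|->] := uv i iR; rewrite ?orbT.
have [e|ne] := eqVneq (t z) (t' z).
  exists (glue D s t'); last first.
    by split; [move=> x xO; rewrite (glue_out _ _ xO) | rewrite satc_glue_in -e].
  rewrite -{1}(glue_id D s); apply/connect1/glink; first exact: satQ.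
  move=> i iR; have [x [/setU1P[->|xO] tx l]] := lk i iR.
    by move: l; rewrite /lit2 /split_lit eqxx => /eqP->; rewrite -/(sel _) sz.
  move: l; rewrite /lit2 /split_lit zO // => l.
  apply/orP; right; apply/satcP; exists x; last by rewrite st.
  by rewrite inE xO st // tx /=.
have agr i : i \in R -> satc lit i [set x in O | t x == t' x] t.
  move=> iR; have [x [/setU1P[->|xO] tx l]] := lk i iR; first by rewrite tx eqxx in ne.
  by apply/satcP; exists x; [rewrite inE xO tx /= | move: l; rewrite /lit2 /split_lit zO].
have agrs i : i \in R -> satc lit i [set x in O | s x == t' x] s.
  move=> /agr/satcP[x]; rewrite inE => /andP[xO /eqP tx] l.
  apply/satcP; exists x; last by rewrite st.
  by rewrite inE xO st // tx /=.
have sO : sat lit R O s.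
  apply/satP=> i /agrs; apply: satcS; apply/subsetP=> x.
  by rewrite inE => /andP[].
have hs : hasD (sel (t' z)) by rewrite /sel; case: ifP.
have [u uQ ur] := hasD_sat hs; exists (glue D u t'); last first.
  by split; [move=> x xO; rewrite (glue_out _ _ xO) | rewrite satc_glue_in].
apply: (@connect_trans _ _ (glue D u s)).
  rewrite -{1}(glue_id D s); apply: connect_slide sO (satQ ss) uQ => //.
by apply/connect1/glink => // i /agrs->; rewrite orbT.
Qed.

Lemma split_lift s t t' : sat lit F W s -> repr s t ->
  connect (link lit2 R W2) t t' ->
  exists2 s', connect (link lit F W) s s' & repr s' t'.
Proof.
move=> ss st; move: t'; apply: connect_ind => [|u v _ [s' ss' s'u] uv].
  by exists s.
have [s'' s's'' s''v] := lift2 (connect_sat ss' ss) s'u uv.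
by exists s'' => //; apply: connect_trans s's''.
Qed.

Definition zcode s := glue [set z] [ffun=> true] s.

Let zcodez s : zcode s z = true. Proof. exact: glue1. Qed.

Let zcodeO s : {in O, zcode s =1 s}.
Proof. by move=> x xO; rewrite /zcode glueE inE zO. Qed.

Lemma repr_zcode s t : {in O, s =1 t} -> satc lit r1 D s -> repr s (zcode t).
Proof.
by move=> st sr; split; [move=> x xO; rewrite zcodeO ?st | rewrite zcodez].
Qed.

Lemma zcode_sat s : (forall i, i \in R -> i != r1 -> satc lit i O s) ->
  sat lit2 R W2 (zcode s).
Proof.
move=> h; apply/satP=> i iR; apply/satc2P; rewrite zcodez /=.
have [->|ne] := eqVneq i r1; [by left|right].
by rewrite (eq_satc _ _ (zcodeO s)); apply: h.
Qed.

Lemma outK_zcode_sat s : sat lit F W s -> ~~ inK s -> satc lit r1 D s ->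
  sat lit2 R W2 (zcode s).
Proof.
move=> ss sK sr; apply: zcode_sat => i iR ir; apply: satR_inO => //.
by apply: contra sK => si; apply: (inK2 ss r1R iR ir sr si).
Qed.

Lemma rho_zcode_sat : sat lit2 R W2 (zcode rho).
Proof. by apply: zcode_sat => i iR _; apply: (satP _ _ _ _ rhoR). Qed.

(** Were the split formula connected, [s] could be carried to a solution agreeing with [rho] on [O],
    hence into the component that it avoids. *)
Lemma split_rich s : sat lit F W s -> ~~ inK s -> satc lit r1 D s ->
  rich lit2 R W2.
Proof.
move=> ss sK sr; apply: IH split_crit _; first by have := cR; nlia.
apply: contra (sK) => /connP c2.
have c := c2 _ _ (outK_zcode_sat ss sK sr) rho_zcode_sat.
have [s' ss' [s'r _]] := split_lift ss (repr_zcode (fun x _ => erefl) sr) c.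
have s'F := connect_sat ss' ss; apply: connect_trans ss' _.
apply: connect_trans (inK_rho (satQ s'F)); apply: connect1.
apply: (link_agree (subxx W)) => // x xW; rewrite glueE; case: ifP => // /negbT xD.
have xO : x \in O by rewrite inE xD.
by rewrite s'r // zcodeO.
Qed.

(** Uniqueness at [z] yields no literal of [F], only a clause satisfied on [D]; outside the
    component of [rho], [outK_unique] turns this into a literal. *)
Lemma split_unique i x s' t' : repr s' t' -> x \in W2 -> i \in R ->
  unique lit2 R i x (t' x) ->
  satc lit i D s' /\ (i == r1) || (i == r2) \/
  x \in O /\ unique lit F i x (s' x).
Proof.
case=> s't' sz /setU1P[->|xO] iR u.
  left; move/andP: (u) => [l _]; move: l; rewrite /lit2 /split_lit eqxx => /eqP e.
  by rewrite e; split=> //; case: (t' z); rewrite eqxx ?orbT.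
right; split=> //; rewrite s't' //; apply: unique_rest (xO) _.
case/uniqueP: u; rewrite /lit2 /split_lit zO // => l h.
by apply/uniqueP; split=> // j jR lj; apply: h; rewrite // zO.
Qed.

End Split.

Let someD : exists z, z \in D.
Proof. by apply/card_gt0P; rewrite tQ. Qed.

Lemma satR_occurs x b : x \in vars lit R O -> exists2 i, i \in F & lit i x b.
Proof.
move=> xR; have [s ss sK] := outK; have [s1 ss1 [r1 r1R s1r]] := has_r ss.
have [r2 [r2R r12 h2]] := other_hasD r1R; have [z zD] := someD.
have s1F := connect_sat ss1 ss; have s1K := notK ss1 sK.
have rich2 := split_rich zD r1R r2R r12 (satc_hasD s1r) h2 s1F s1K s1r.
have xO := subsetP (vars_sub _ _ _) _ xR.
have xz : (x == z) = false.
  by move: xO; rewrite inE => /andP[xD _]; apply: contraNF xD => /eqP->.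
have [|i iR l] := rich2.1 x b.
  case/varsP: xR => i [c [_ iR l]]; apply/varsP; exists i, c.
  by rewrite setU1r // /split_lit xz.
exists i; first by move: iR; rewrite inE => /andP[].
by move: l; rewrite /split_lit xz.
Qed.

Lemma outK_rich s i : sat lit F W s -> ~~ inK s -> i \in R ->
  exists2 t, connect (link lit F W) s t &
  exists2 x, x \in W & unique lit F i x (t x).
Proof.
move=> ss sK iR; have [s1 ss1 [r1 r1R s1r]] := has_r ss.
have [r2 [r2R r12 h2]] := other_hasD r1R; have [z zD] := someD.
have s1F := connect_sat ss1 ss; have s1K := notK ss1 sK.
have h1 := satc_hasD s1r.
have [_ rich2] := split_rich zD r1R r2R r12 h1 h2 s1F s1K s1r.
have [t' ct [x xW u]] := rich2 _ _ iR (outK_zcode_sat _ zD r1R s1F s1K s1r).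
have [s' s1s' rep] :=
  split_lift zD h1 h2 s1F (repr_zcode r2 zD (fun x _ => erefl) s1r) ct.
have ss' := connect_trans ss1 s1s'.
have [[s'i _]|[xO us']] := split_unique zD rep xW iR u; last first.
  by exists s' => //; exists x => //; apply: (subsetP OW).
have s'K := notK ss' sK; have s'F := connect_sat ss' ss.
have [s2 s's2 [y yD uy]] := outK_unique s'F s'K iR s'i.
exists s2; first exact: connect_trans ss' s's2.
by exists y => //; apply: (subsetP DW).
Qed.

Lemma inK_rich i : i \in R ->
  exists2 t, inK t & exists2 x, x \in W & unique lit F i x (t x).
Proof.
move=> iR.
have uD x b : x \in D -> unique lit F i x b ->
    exists2 t, inK t & exists2 x, x \in W & unique lit F i x (t x).
  move=> xD u; have [t tQ' tx] := hall1_sat_fix b xD hQ.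
  exists (glue D t rho); first exact: inK_rho.
  by exists x; [apply: (subsetP DW) | rewrite glue_in // tx].
have uS s : sat lit F W s -> ~~ inK s -> satc lit i D s ->
    exists2 t, inK t & exists2 x, x \in W & unique lit F i x (t x).
  by move=> ss sK si; have [s' _ [x xD u]] := outK_unique ss sK iR si; apply: uD u.
have [s ss sK] := outK; have [s1 ss1 [r1 r1R s1r]] := has_r ss.
have s1F := connect_sat ss1 ss; have s1K := notK ss1 sK.
have h1 := satc_hasD s1r; have [z zD] := someD.
have [e|ir1] := eqVneq i r1; first by apply: (uS s1); rewrite // e.
have [hi|hi] := boolP (hasD i); last first.
  (* Having no literal on [D], [i] is neither [r1] nor [r2], so its unique literal is not at [z];
     the path can start from [rho] itself. *)
  have [r2 [r2R r12 h2]] := other_hasD r1R.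
  have [_ rich2] := split_rich zD r1R r2R r12 h1 h2 s1F s1K s1r.
  have [t tQ' tr] := hasD_sat h1.
  have [t' ct [x xW u]] := rich2 _ _ iR (rho_zcode_sat r1 r2 zD).
  have rep0 : repr z r1 r2 (glue D t rho) (zcode z rho).
    by apply: repr_zcode; rewrite // ?satc_glue_in //; apply: glue_out.
  have [s' ss' rep] := split_lift zD h1 h2 (sat_rho tQ') rep0 ct.
  have [[_ /orP[/eqP e|/eqP e]]|[xO us']] := split_unique zD rep xW iR u.
  - by rewrite e h1 in hi.
  - by rewrite e h2 in hi.
  exists s'; last by exists x => //; apply: (subsetP OW).
  by apply: connect_trans (inK_rho tQ'); rewrite connect_link_sym.
have [_ rich2] := split_rich zD r1R iR ir1 h1 hi s1F s1K s1r.
have [t' ct [x xW u]] := rich2 _ _ iR (outK_zcode_sat _ zD r1R s1F s1K s1r).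
have [s' s1s' rep] :=
  split_lift zD h1 hi s1F (repr_zcode i zD (fun x _ => erefl) s1r) ct.
have s'F := connect_sat s1s' s1F; have s'K := notK s1s' s1K.
have [[s'i _]|[xO us']] := split_unique zD rep xW iR u; first exact: (uS s').
have [t tQ' ti] := hasD_sat hi.
have [t2 tt2 [y [yD [r rR l] noQ]]] :
    exists2 t2, connect (link lit1 F1 D) t t2
    & exists y, [/\ y \in D, exists2 r, r \in R & lit r y (t2 y)
                & forall j, j \in Q -> ~~ lit j y (t2 y)].
  have t1 : sat lit1 F1 D t by apply/merge_sat=> //; split=> //; exists i.
  have [t2 tt2 [y yD uy]] := rich1.2 _ _ (setU11 r0 Q) t1.
  by exists t2 => //; exists y; case: (merge_uniqueR r0R uy).
(* The literal of [i] at [x] was found outside the component. Values on [D] satisfying [i] and a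
   second clause of [R] bring it inside, and leave surplus one off [D] for prescribing [x]. *)
pose two v := exists r', [/\ r' \in R, r' != i, sat lit Q D v, satc lit i D v
                            & satc lit r' D v].
have finish v : two v ->
    exists2 t, inK t & exists2 x, x \in W & unique lit F i x (t x).
  case=> r' [r'R r'i vQ vi vr'].
  have [|w ww wx] := @hall1_sat_fix lit (R :\ i :\ r') O x (s' x) xO.
    apply: hallR2; first by rewrite (subset_trans (subsetDl _ _)) ?subsetDl.
    have := cardsD1 i R; have := cardsD1 r' (R :\ i).
    by rewrite in_setD1 r'i r'R iR /=; nlia.
  have gF : sat lit F W (glue D v w).
    apply: sat_glue => // k kF; have [kQ|kQ] := boolP (k \in Q).
      by rewrite (satP _ _ _ _ vQ).
    have [->|ki] := eqVneq k i; first by rewrite vi.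
    have [->|kr] := eqVneq k r'; first by rewrite vr'.
    by rewrite (satP _ _ _ _ ww) ?orbT // !in_setD1 ki kr inE kQ.
  exists (glue D v w); last first.
    by exists x; [apply: (subsetP OW) | rewrite (glue_out _ _ xO) wx].
  by apply: (inK2 gF iR r'R r'i); rewrite satc_glue_in.
(* Each link of the merged formula keeps a clause of [R] satisfied: the path meets such values, or
   [i] stays satisfied to its end. *)
have [[v /finish//]|t2i] : (exists v, two v) \/ satc lit i D t2.
  move: t2 tt2 {y yD r rR l noQ}; apply: connect_ind; first by right.
  move=> u' v _ [|ui] lk; first by left.
  have [uQ _ _ [r [rR ur vr _]]] := link1P lk.
  have [<-|ri] := eqVneq r i; first by right.
  by left; exists u', r.
have t2Q : sat lit Q D t2.
  have t1 : sat lit1 F1 D t by apply/merge_sat=> //; split=> //; exists i.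
  by have /(merge_sat _ _ _ r0R)[] := connect_sat tt2 t1.
have [/existsP[j /and3P[jR ji lj]]|/existsPn no] :=
    boolP [exists j, [&& j \in R, j != i & lit j y (t2 y)]].
  by apply: (finish t2); exists j; split=> //; apply/satcP; exists y.
apply: (uD y (t2 y)) => //.
have only j : j \in R -> lit j y (t2 y) -> j = i.
  by move=> jR lj; apply/eqP; have := no j; rewrite jR lj andbT negbK.
apply/uniqueP; split=> [|j jF lj]; first by rewrite -(only r).
have [jQ|jQ] := boolP (j \in Q); first by rewrite (negPf (noQ j jQ)) in lj.
by apply: only; rewrite // inE jQ.
Qed.

End RestSat.

Lemma rich_tight : rich lit F W.
Proof.
have [s0 s0Q] := hall_sat (hallW (leq0n 1) (subxx Q) (subxx D) hQ).
have [/existsP[rho rhoR]|/existsPn no] := boolP [exists rho, sat lit R O rho].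
  split=> [x b xF|i s iF ss].
    have [xD|xD] := boolP (x \in D); first exact: tight_occursD.
    apply: (satR_occurs rhoR s0Q).
    case/varsP: xF => i [c [xW iF l]]; apply/varsP; exists i, c.
    split=> //; first by rewrite inE xD.
    rewrite inE iF andbT; apply: contra xD => iQ; exact: varsE l.
  have [iQ|iQ] := boolP (i \in Q); first exact: tight_uniqueQ.
  have iR : i \in R by rewrite inE iQ.
  have [sK|sK] := boolP (connect (link lit F W) s (glue D s0 rho)); last first.
    exact: (outK_rich rhoR s0Q ss sK iR).
  have [t tK ux] := inK_rich rhoR s0Q iR; exists t => //.
  by apply: connect_trans sK _; rewrite connect_link_sym.
split=> [x b xF|i s iF ss].
  have [xD|xD] := boolP (x \in D); first exact: tight_occursD.
  apply: (unsatR_occurs no).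
    by rewrite inE xD (subsetP (vars_sub _ _ _) _ xF).
  case/varsP: xF => i [c [xW iF l]]; apply/varsP; exists i, c.
  split=> //; first by rewrite inE xD.
  rewrite inE iF andbT; apply: contra xD => iQ; exact: varsE l.
have [iQ|iQ] := boolP (i \in Q); first exact: tight_uniqueQ.
by apply: (unsatR_unique no) => //; rewrite inE iQ.
Qed.

End Tight.

(** * From critical formulas to minimal disconnected ones *)

Lemma critical_rich lit F W :
  critical lit F W -> ~~ conn lit F W -> rich lit F W.
Proof.
suff h n : rich_below n by apply: (h #|F|.+1).
elim: n => // n IHn {}lit {}F {}W Fn crit nconn.
have IH : rich_below #|F| by move=> l' F' W' lt; apply: IHn; nlia.
pose tight Q := [&& Q \subset F, Q != set0, #|vars lit Q W| == #|Q|.+1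
                 & #|Q| + 2 <= #|F|].
case: (boolP [exists Q, tight Q]) => [/existsP|/existsPn nt].
  case/(@max_card_set _ tight) => Q /and4P[QF Qnz /eqP tQ leQ] maxQ.
  have [r0 r0R] : exists r, r \in F :\: Q.
    by apply/card_gt0P; have := cards_rest QF; nlia.
  apply: (rich_tight IH crit nconn QF Qnz tQ leQ _ r0R) => Q' QF' nz' tQ' le'.
  by apply: maxQ; rewrite /tight QF' nz' tQ' eqxx.
apply: rich_loose => // Q QF nz le.
have := nt Q; rewrite /tight QF nz le andbT /= => ne.
have : #|Q| < #|vars lit Q W|.
  by apply: crit.2 => //; rewrite properEcard QF; nlia.
by rewrite leq_eqVlt eq_sym (negPf ne) /= addn2.
Qed.

Lemma link_vars lit F W s t :
  link lit F W s t -> link lit F (vars lit F W) s t.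
Proof.
move=> /linkP h; apply/linkP=> i iF; have [x [xW e l]] := h i iF.
by exists x; split=> //; apply: varsE l.
Qed.

(** Take a maximal proper [Q] without surplus, if any. By [conn_extend], [R] is disconnected off [D]
    and no solution of [Q] satisfies a clause of [R] on [D]. Hence [R] is critical off [D], while
    [Q] with [R] merged is minimal unsatisfiable on [D]. *)
Theorem min_disconnected_unique lit F W :
  #|F| = #|vars lit F W| -> ~~ conn lit F W ->
  (forall i, i \in F -> conn lit (F :\ i) W) ->
  forall i, i \in F -> exists x b, x \in W /\ unique lit F i x b.
Proof.
move=> cF nconn minF.
have [s0 s0F] : exists s, sat lit F W s.
  apply/existsP; apply: contraR nconn => /existsPn no.
  by apply/connP=> s t ss; have := no s; rewrite ss.
pose bad Q := [&& Q \proper F, Q != set0 & #|vars lit Q W| <= #|Q|].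
case: (boolP [exists Q, bad Q]) => [/existsP|/existsPn nbad]; last first.
  have crit : critical lit F W.
    split=> // Q pr nz; rewrite ltnNge.
    by have := nbad Q; rewrite /bad pr nz.
  move=> i iF; have [_ rich] := critical_rich crit nconn.
  by have [t _ [x xW u]] := rich i s0 iF s0F; exists x, (t x).
case/(@max_card_set _ bad) => Q /and3P[prQ Qnz leQ] maxQ.
have QF := proper_sub prQ; have cQR := cards_rest QF.
set D := vars lit Q W in leQ *; set R := F :\: Q in cQR *; set O := W :\: D.
have DW : D \subset W by apply: vars_sub.
have cO : #|F| = #|D| + #|vars lit R O|.
  by rewrite -(vars_card_split lit Q R W) setUDK.
have surR R' : R' \proper R -> R' != set0 -> #|R'| + #|Q| < #|vars lit R' O| + #|D|.
  move=> pr nz; have sR := proper_sub pr; have sQR := subU_rest QF sR.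
  have c1 := vars_card_split lit Q R' W; have c2 := cardsU_rest sR.
  rewrite -/D -/O in c1; have lt := proper_card pr.
  rewrite ltnNge; apply/negP=> le.
  have /maxQ : bad (Q :|: R').
    rewrite /bad properEcard sQR setU_eq0 (negPf Qnz) c2 cQR ltn_add2l lt /=.
    by rewrite c1; nlia.
  by rewrite c2; move: nz; rewrite -card_gt0; nlia.
have hallR R' : R' \proper R -> hall lit 1 R' O.
  move=> pr R1 sR nz; have := surR R1 (sub_proper_trans sR pr) nz; nlia.
have cRp R' : R' \proper R -> conn lit R' O by move/hallR/hall1_conn.
have [rho rhoR] : exists t, sat lit R O t.
  apply: hall_sat => R' sR nz; have [e|ne] := eqVneq R' R.
    by rewrite e; nlia.
  by have := surR R'; rewrite properEneq ne sR => /(_ isT nz); nlia.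
have [r0 r0R] : exists r, r \in R by apply/card_gt0P; have := proper_card prQ; nlia.
(* Deleting a clause outside [Q] leaves a connected formula containing [Q], whose paths restrict to
   [Q]. *)
have cQ : conn lit Q D.
  apply: (@conn_via _ _ _ (fun s => sat lit F W s)) => [s ss|s t ss st].
    exists (glue D s rho); first exact: sat_glue2 rhoR.
    by apply/connect1/(link_agree (subxx D)) => // x xD; rewrite glue_in.
  have r0F : r0 \in F by move: r0R; rewrite inE => /andP[].
  have sub : Q \subset F :\ r0.
    apply/subsetP=> k kQ; rewrite in_setD1 (subsetP QF) // andbT.
    by apply: contraTneq r0R => <-; rewrite inE kQ.
  have satW u : sat lit F W u -> sat lit (F :\ r0) W u.
    exact: satS (subsetDl _ _) (subxx _).
  have /connP c := minF r0 r0F; have := c s t (satW s ss) (satW t st).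
  apply: (connect_map (f := id)) => u v uv; apply/connect1/link_vars.
  exact: linkS sub (subxx W) uv.
have ext := conn_extend QF cQ rhoR cRp.
have nR : ~~ conn lit R O by apply: contra nconn => c; apply: ext; left.
have noP s r : sat lit Q D s -> r \in R -> ~~ satc lit r D s.
  move=> sQ rR; apply: contra nconn => sr; apply: ext; right.
  by exists r, s.
have eD : #|D| = #|Q|.
  apply/eqP; rewrite eqn_leq leQ leqNgt; apply: contra nR => lt.
  apply: hall1_conn => R' sR nz; have [e|ne] := eqVneq R' R.
    by rewrite e; nlia.
  by have := surR R'; rewrite properEneq ne sR => /(_ isT nz); nlia.
move=> i iF; have [iQ|iQ] := boolP (i \in Q); last first.
  have crit : critical lit R O.
    split; first by nlia.
    by move=> R' pr nz; have := surR R' pr nz; nlia.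
  have iR : i \in R by rewrite inE iQ.
  have [_ rich] := critical_rich crit nR.
  have [t _ [x xO u]] := rich i rho iR rhoR.
  exists x, (t x); split; first exact: (subsetP (subsetDl _ _) _ xO).
  exact: unique_rest xO u.
have cF1 := merge_card lit r0R.
have s0Q : sat lit Q D s0 by apply: sat_vars; apply: satS s0F.
have Q0 : 0 < #|Q| by rewrite card_gt0.
have [|||||x [b [xD u]]] :=
    @min_unsat_unique (merge lit R r0) (r0 |: Q) D _ _ _ _ i _.
- move=> s; apply/negP=> /(merge_sat _ _ _ r0R)[sQ [r rR]].
  by apply/negP/noP.
- move=> j /setU1P[->|jQ].
    exists s0; have sQ : sat (merge lit R r0) Q D s0 by rewrite merge_satQ.
    apply: satS _ (subxx D) sQ; apply/subsetP=> k.
    by rewrite !inE => /andP[/negPf->].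
  have [/existsP[s /andP[sQ /exists_inP[r rR sr]]]|/existsPn no] :=
      boolP [exists s, sat lit (Q :\ j) D s && [exists r in R, satc lit r D s]].
    exists s; apply/satP=> k; rewrite in_setD1 => /andP[kj /setU1P[->|kQ]].
      by apply/merge_satcR; exists r.
    by rewrite merge_satcQ // (satP _ _ _ _ sQ) // in_setD1 kj.
  have noP' s r : sat lit (Q :\ j) D s -> r \in R -> ~~ satc lit r D s.
    by move=> sQ; have := no s; rewrite sQ /= => /exists_inPn; apply.
  (* If no solution of [Q :\ j] satisfies a clause of [R] on [D], paths for [F :\ j] restrict to
     paths for [R] on [O]. *)
  case/negP: nR; apply/connP=> s t sR tR.
  have sg u : sat lit R O u -> sat lit (F :\ j) W (glue D s0 u).
    move=> uR; apply: satS (subsetDl _ _) (subxx W) _.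
    exact: sat_glue2 s0Q uR.
  have /connP c := minF j (subsetP QF _ jQ).
  have toO u : sat lit R O u -> connect (link lit R O) u (glue D s0 u).
    move=> uR; apply/connect1/(link_agree (subxx O)) => // x xO.
    by rewrite (glue_out _ _ xO).
  apply: connect_trans (toO s sR) _; rewrite connect_link_sym.
  apply: connect_trans (toO t tR) _; rewrite connect_link_sym.
  have := c _ _ (sg s sR) (sg t tR).
  apply: (connect_map (f := id)) => u v uv; apply/connect1/linkP => r rR.
  have rF : r \in F :\ j.
    move: (rR); rewrite !inE => /andP[rQ ->]; rewrite andbT.
    by apply: contraNneq rQ => ->.
  have [x [xW e l]] := linkP _ _ _ _ _ uv r rF; exists x; split=> //.
  rewrite inE xW andbT; apply/negP=> xD.
  have uQ : sat lit (Q :\ j) D u.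
    have := sat_vars (satS (setSD _ QF) (subxx W) (link_satl uv)).
    by apply: satS => //; apply: varsS => //; apply: subsetDl.
  by case/negP: (noP' u r uQ rR); apply/satcP; exists x.
- rewrite cF1 -eD merge_varsU // setUDK //; congr _.+1; apply/eqP.
  rewrite eqn_leq !subset_leq_card ?vars_sub //.
  apply/subsetP=> x /varsP[j [c [xW jQ l]]].
  exact: varsE (varsE xW jQ l) (subsetP QF _ jQ) l.
- by nlia.
- by rewrite setU1r.
by exists x, b; split; [apply: (subsetP DW) | apply: merge_uniqueQ u].
Qed.

End Formula.

(** * From graphs to formulas *)

Lemma complete_bipartite_sym (T : finType) (G : graph T) (A B : {set T}) :
  complete_bipartite G A B -> complete_bipartite G B A.
Proof.
case=> A0 B0 dAB vE aE; split=> //; first by rewrite disjoint_sym.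
  by rewrite vE setUC.
by move=> x y xG yG; rewrite aE // orbC.
Qed.

Lemma card_transversal_set (T : finType) (P : {set {set T}}) (S : {set T}) :
  trivIset P -> S \subset cover P -> (forall U, U \in P -> #|S :&: U| = 1) ->
  #|S| = #|P|.
Proof.
move=> tI SP S1.
transitivity (\sum_(x in cover P | x \in S) 1).
  rewrite sum1dep_card; apply: eq_card => x; rewrite !inE.
  by case: (boolP (x \in S)) => [/(subsetP SP)->|]; rewrite ?andbF.
rewrite big_trivIset_cond // -sum1_card; apply: eq_bigr => U UP.
by rewrite sum1dep_card -(S1 U UP); apply: eq_card => x; rewrite !inE andbC.
Qed.

Section Translation.
Variables (T : finType) (G : graph T) (P : {set {set T}}).
Hypothesis G_simple : simple_graph G.
Hypothesis P_partition : partition P (vset G).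
Variable side : {set T} -> bool -> {set T}.
Let W := components G.
Hypothesis sideP : forall C, C \in W ->
  complete_bipartite (induced G C) (side C true) (side C false).

Let comp x := pblock W x.

Let connect_equiv : {in vset G & &, equivalence_rel (connect (adj G))}.
Proof.
case: G_simple => symG _ _ x y z _ _ _; split; first exact: connect0.
by move=> xy; apply: same_connect; [apply: sym_connect_sym | ].
Qed.

Let W_partition : partition W (vset G).
Proof. exact: equivalence_partitionP connect_equiv. Qed.

Let compW x : x \in vset G -> comp x \in W.
Proof.
by move=> xG; apply: pblock_mem; rewrite (cover_partition W_partition).
Qed.

Let in_comp x : x \in vset G -> x \in comp x.
Proof. by move=> xG; rewrite mem_pblock (cover_partition W_partition). Qed.

Let comp_eq C x : C \in W -> x \in C -> comp x = C.
Proof. by case/and3P: W_partition => _ tI _; apply: def_pblock. Qed.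

Let adj_comp x y : adj G x y -> comp x = comp y.
Proof.
case: G_simple => symG _ aV xy; have [xG yG] := aV x y xy.
apply/esym/comp_eq; first exact: compW.
rewrite /comp /W /components pblock_equivalence_partition //; exact: connect1.
Qed.

Let side_cover C x : C \in W ->
  (x \in vset G) && (x \in C) = (x \in side C true) || (x \in side C false).
Proof. by move=> /sideP[_ _ _ /setP/(_ x)]; rewrite !inE. Qed.

Let side_mem C b x : C \in W -> x \in side C b -> x \in vset G /\ x \in C.
Proof.
move=> CW xb; apply/andP; rewrite side_cover //.
by case: b xb => ->; rewrite ?orbT.
Qed.

Let side_comp C b x : C \in W -> x \in side C b -> comp x = C.
Proof. by move=> CW /(side_mem CW)[_]; apply: comp_eq. Qed.

Let has_side x : x \in vset G -> exists b, x \in side (comp x) b.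
Proof.
move=> xG; have := side_cover x (compW xG); rewrite xG in_comp //.
by case: (boolP (x \in side _ true)) => [h|_ /esym h]; [exists true|exists false].
Qed.

Let side_inj C b c x : C \in W -> x \in side C b -> x \in side C c -> b = c.
Proof.
case/sideP=> _ _ /pred0P/(_ x) /= d _ _.
by case: b c => [] [] // h1 h2; rewrite h1 h2 in d.
Qed.

Let adj_side C b c x y : C \in W -> x \in side C b -> y \in side C c ->
  adj G x y = (b != c).
Proof.
move=> CW xb yc; have [xG xC] := side_mem CW xb; have [yG yC] := side_mem CW yc.
have [_ _ _ _ aE] := sideP CW.
have -> : adj G x y = adj (induced G C) x y by rewrite /= xC yC.
rewrite aE ?inE ?xG ?xC ?yG ?yC //.
have inb d e z : z \in side C d -> (z \in side C e) = (d == e).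
  move=> zd; apply/idP/eqP => [|<- //]; exact: side_inj CW zd.
by rewrite !(inb _ _ _ xb) !(inb _ _ _ yc); case: (b) (c) => [] [].
Qed.

Definition meets (U C : {set T}) b := [exists v in U, v \in side C b].

(** Components missed by [S] get [false], an arbitrary default. *)
Definition assign (S : {set T}) : {ffun {set T} -> bool} :=
  [ffun C => [exists v in S, v \in side C true]].

Definition compatible (s : {ffun {set T} -> bool}) (S : {set T}) :=
  forall v C b, v \in S -> C \in W -> v \in side C b -> s C = b.

Lemma compatibleS s (S S' : {set T}) :
  S' \subset S -> compatible s S -> compatible s S'.
Proof. by move=> /subsetP sS h v C b /sS; apply: h. Qed.

(** * Reconfiguration of transversals and links, for any subfamily of blocks *)

Section Subpartition.
Variables (H : graph T) (P' : {set {set T}}).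
Implicit Types (S U : {set T}) (s t : {ffun {set T} -> bool}).
Hypothesis sP : P' \subset P.
Hypothesis HV : vset H = cover P'.
Hypothesis HA : forall x y, x \in vset H -> y \in vset H ->
  adj H x y = adj G x y.

Let tI : trivIset P'.
Proof. by case/and3P: P_partition => _ tP _; apply: trivIsetS tP. Qed.

Let HG x : x \in vset H -> x \in vset G.
Proof.
rewrite HV -(cover_partition P_partition) => /bigcupP[U UP xU].
by apply/bigcupP; exists U => //; apply: (subsetP sP).
Qed.

Let block_vset U x : U \in P' -> x \in U -> x \in vset H.
Proof. by move=> UP xU; rewrite HV; apply/bigcupP; exists U. Qed.

Let block_eq U U' x : U \in P' -> U' \in P' -> x \in U -> x \in U' -> U = U'.
Proof.
move=> UP UP' xU xU'.
by rewrite -(def_pblock tI UP xU) (def_pblock tI UP' xU').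
Qed.

Lemma compatible_independent s S :
  S \subset vset H -> compatible s S -> independent H S.
Proof.
move=> /subsetP SH cS; rewrite /independent; apply/andP; split; first exact/subsetP.
apply/forall_inP=> x xS; apply/forall_inP=> y yS; rewrite HA ?SH //.
apply/negP=> xy; have [b xb] := has_side (HG (SH x xS)).
have [c yc] := has_side (HG (SH y yS)); have xW := compW (HG (SH x xS)).
rewrite -(adj_comp xy) in yc.
by move: xy; rewrite (adj_side xW xb yc) -(cS _ _ _ xS xW xb) -(cS _ _ _ yS xW yc) eqxx.
Qed.

Lemma independent_compatible S : independent H S -> compatible (assign S) S.
Proof.
case/andP=> /subsetP SH /forall_inP ind v C b vS CW vb; rewrite ffunE.
apply/exists_inP/idP => [[w wS wt]|bt].
  case: b vb => // vf; have /forall_inP/(_ w wS) := ind v vS.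
  by rewrite HA ?SH // (adj_side CW vf wt).
by exists v => //; rewrite bt in vb.
Qed.

Lemma IT_independent S : indep_transversal H P' S -> independent H S.
Proof. by case/andP. Qed.

Lemma IT_sub S : indep_transversal H P' S -> S \subset vset H.
Proof. by case/andP=> /andP[]. Qed.

Lemma IT_block S U : indep_transversal H P' S -> U \in P' ->
  exists v, S :&: U = [set v].
Proof. by case/andP=> _ /forall_inP h /h /cards1P. Qed.

Lemma IT_card S : indep_transversal H P' S -> #|S| = #|P'|.
Proof.
move=> ITS; apply: card_transversal_set => //; first by rewrite -HV IT_sub.
by move=> U UP; have [v ->] := IT_block ITS UP; rewrite cards1.
Qed.

Lemma assign_link S s : indep_transversal H P' S -> compatible s S ->
  link meets P' W (assign S) s.
Proof.
move=> ITS cS; apply/linkP=> U UP; have [v Sv] := IT_block ITS UP.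
have /setIP[vS vU] : v \in S :&: U by rewrite Sv set11.
have vG := HG (block_vset UP vU); have [b vb] := has_side vG.
exists (comp v); rewrite (cS v _ b) // ?compW //.
rewrite (independent_compatible (IT_independent ITS) vS _ vb) ?compW //.
by split=> //; apply/exists_inP; exists v.
Qed.

(** In each block a vertex is picked from a side on which [s] and [t] agree; vertices in sides
    chosen by one assignment are not adjacent. *)
Lemma link_IT s t : link meets P' W s t ->
  exists S, [/\ indep_transversal H P' S, compatible s S & compatible t S].
Proof.
move=> /linkP lk.
pose good v := [exists C in W, (s C == t C) && (v \in side C (s C))].
pose S := [set v | [exists U in P', [pick w in U | good w] == Some v]].
have goodS v : v \in S -> exists2 U, U \in P' & v \in U /\ good v.
  rewrite inE => /exists_inP[U UP]; case: pickP => // w /andP[wU gw] /eqP[<-].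
  by exists U.
have cS u : u \in S -> forall C b, C \in W -> u \in side C b -> s C = b /\ t C = b.
  move=> /goodS[U _ [_ /exists_inP[C' C'W /andP[/eqP e uC']]]] C b CW uC.
  have eC : C' = C by rewrite -(side_comp C'W uC') (side_comp CW uC).
  by rewrite eC in e uC'; rewrite -e (side_inj CW uC' uC).
have cs : compatible s S by move=> v C b vS CW vb; case: (cS v vS C b CW vb).
exists S; split=> //; last by move=> v C b vS CW vb; case: (cS v vS C b CW vb).
have SH : S \subset vset H.
  by apply/subsetP=> v /goodS[U UP [vU _]]; apply: block_vset vU.
apply/andP; split; first exact: compatible_independent SH cs.
apply/forall_inP=> U UP; have [C [CW e /exists_inP[v vU vC]]] := lk U UP.
have gv : good v by apply/exists_inP; exists C; rewrite // e eqxx -e.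
have [x px] : exists x, [pick w in U | good w] = Some x.
  by case: pickP => [x _|/(_ v)]; [exists x | rewrite vU gv].
apply/cards1P; exists x; apply/setP=> u; rewrite !inE.
apply/andP/eqP => [[/exists_inP[U' UP' /eqP pu] uU]|->]; last first.
  split; first by apply/exists_inP; exists U => //; apply/eqP.
  by move: px; case: pickP => // y /andP[yU _] [<-].
have uU' : u \in U' by move: pu; case: pickP => // y /andP[yU _] [<-].
by move: pu; rewrite (block_eq UP' UP uU' uU) px => -[].
Qed.

(** The sides chosen by [s] together form an independent set, so the vertices of [S] can be
    exchanged for those of [S'] one block at a time. *)
Lemma compatible_connect s S S' :
  indep_transversal H P' S -> indep_transversal H P' S' ->
  compatible s S -> compatible s S' -> connect (adj (RG H P')) S S'.
Proof.
have [n] := ubnP #|S' :\: S|; elim: n => // n IH in S *.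
move=> /ltnSE len ITS ITS' cS cS'.
have [sub|/subsetPn[v' v'S' v'S]] := boolP (S' \subset S).
  suff -> : S' = S by apply: connect0.
  by apply/eqP; rewrite eqEcard sub (IT_card ITS) (IT_card ITS') leqnn.
have v'H := subsetP (IT_sub ITS') _ v'S'.
have [U UP v'U] : exists2 U, U \in P' & v' \in U.
  by move: v'H; rewrite HV => /bigcupP[U]; exists U.
have [v Sv] := IT_block ITS UP.
have /setIP[vS vU] : v \in S :&: U by rewrite Sv set11.
have [w Sw] := IT_block ITS' UP.
have ew : v' = w by apply/set1P; rewrite -Sw inE v'S'.
have vS' : v \notin S'.
  apply/negP=> vS'; have /set1P e : v \in [set w] by rewrite -Sw inE vS'.
  by move: v'S; rewrite ew -e vS.
pose S2 := v' |: (S :\ v).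
have S2sub : S2 \subset v' |: S by apply: setUS; apply: subsetDl.
have cU : compatible s (v' |: S).
  by move=> x C b /setU1P[->|xS]; [apply: cS' | apply: cS].
have UH : v' |: S \subset vset H by rewrite subUset sub1set v'H IT_sub.
have iU : independent H (v' |: S) by apply: compatible_independent UH cU.
have c2 := compatibleS S2sub cU.
have IT2 : indep_transversal H P' S2.
  apply/andP; split; first exact: compatible_independent (subset_trans S2sub UH) c2.
  apply/forall_inP=> U' UP'; apply/cards1P; have [e|ne] := eqVneq U' U.
    exists v'; apply/setP=> x; rewrite !inE; have [->|xv'] /= := eqVneq x v'.
      by rewrite e v'U.
    apply/negP=> /andP[/andP[xv xS] xU].
    have /set1P : x \in [set v] by rewrite -Sv inE xS -e.
    by move/eqP; rewrite (negPf xv).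
  have [u Su] := IT_block ITS UP'; exists u; rewrite -Su.
  apply/setP=> x; rewrite !inE; have [xU|] := boolP (x \in U'); rewrite ?andbF ?andbT //.
  have [xv'|_] /= := eqVneq x v'.
    by case/eqP: ne; apply: block_eq xU _; rewrite ?xv'.
  have [xv|//] := eqVneq x v.
  by case/eqP: ne; apply: block_eq xU _; rewrite ?xv.
apply: (@connect_trans _ _ S2).
  apply: connect1; rewrite /= ITS IT2 /=.
  have -> : S :|: S2 = v' |: S.
    rewrite setUCA; congr (_ |: _); apply/setUidPl; exact: subsetDl.
  by rewrite iU cardsU1 v'S (IT_card ITS) add1n eqxx.
apply: IH => //; apply: leq_trans len.
apply: proper_card; apply/properP; split.
  apply/subsetP=> x; rewrite !inE negb_or negb_and negbK.
  case/andP=> /andP[_ /orP[/eqP->|->]] // vS2.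
  by rewrite vS2 in vS'.
by exists v'; rewrite !inE ?v'S ?v'S' ?eqxx.
Qed.

Lemma conn_RG : conn meets P' W -> connected_graph (RG H P').
Proof.
move=> /connP c; apply/forall_inP=> S; rewrite inE => ITS.
apply/forall_inP=> S'; rewrite inE => ITS'.
have satA X : indep_transversal H P' X ->
    compatible (assign X) X /\ sat meets P' W (assign X).
  move=> ITX; have cX := independent_compatible (IT_independent ITX).
  by split=> //; apply: link_satl (assign_link ITX cX).
have [cS sS] := satA S ITS; have [cS' sS'] := satA S' ITS'.
have := c _ _ sS sS'; pose Q t := forall X, indep_transversal H P' X ->
  compatible t X -> connect (adj (RG H P')) S X.
move=> ct; have : Q (assign S'); last exact.
apply: connect_ind ct => [X ITX cX|u v _ Qu uv X ITX cX].
  exact: compatible_connect cS cX.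
have [Y [ITY uY vY]] := link_IT uv.
apply: connect_trans (Qu Y ITY uY) _; exact: compatible_connect vY cX.
Qed.

Lemma RG_conn : connected_graph (RG H P') -> conn meets P' W.
Proof.
move=> /forall_inP c; apply/connP=> s t ss tt.
have toIT u : sat meets P' W u -> exists S, indep_transversal H P' S /\
    connect (link meets P' W) (assign S) u.
  move=> uu; have : link meets P' W u u by apply: (link_agree (subxx W)).
  case/link_IT=> S [ITS cS _]; exists S; split=> //.
  exact/connect1/assign_link.
have [S [ITS sS]] := toIT s ss; have [S' [ITS' tS']] := toIT t tt.
rewrite connect_link_sym in sS; apply: connect_trans sS (connect_trans _ tS').
have SV : S \in vset (RG H P') by rewrite inE.
have S'V : S' \in vset (RG H P') by rewrite inE.
have := forall_inP (c S SV) S' S'V; apply: connect_map => X Y /and4P[ITX ITY iXY _].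
have cXY := independent_compatible iXY.
(* The union of adjacent transversals is independent, so one assignment is compatible with both. *)
apply: (@connect_trans _ _ (assign (X :|: Y))).
  by apply/connect1/assign_link => //; apply: compatibleS cXY; apply: subsetUl.
rewrite connect_link_sym; apply/connect1/assign_link => //.
by apply: compatibleS cXY; apply: subsetUr.
Qed.

End Subpartition.

Lemma meets_unique U C b : U \in P -> C \in W -> unique meets P U C b ->
  side C b \subset U.
Proof.
move=> UP CW /uniqueP[_ u]; apply/subsetP=> v vb.
have [vG _] := side_mem CW vb.
move: vG; rewrite -(cover_partition P_partition) => /bigcupP[U' UP' vU'].
by rewrite -(u U' UP') //; apply/exists_inP; exists v.
Qed.

(** Since sides are nonempty, every component is met by a block; the number of variables is
    therefore the number of components. *)
Lemma meets_vars : vars meets P W = W.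
Proof.
apply/eqP; rewrite eqEsubset vars_sub; apply/subsetP=> C CW.
have [/set0Pn[v vA] _ _ _ _] := sideP CW; have [vG _] := side_mem CW vA.
move: vG; rewrite -(cover_partition P_partition) => /bigcupP[U UP vU].
by apply: (varsE (b := true) CW UP); apply/exists_inP; exists v.
Qed.

End Translation.

Theorem theorem2p5 (T : finType) (G : graph T) (P : {set {set T}})
    (G_simple : simple_graph G)
    (P_partition : partition P (vset G))
    (GP_min : minimally_RGD G P)
    (G_bip : union_of_complete_bipartite G)
    (G_comp : #|components G| = #|P|) :
  forall U : {set T}, U \in P ->
    exists C A B : {set T},
      [/\ C \in components G, complete_bipartite (induced G C) A B
        & A \subset U].
Proof.
have [side sideP] : exists side : {set T} -> bool -> {set T},
    forall C, C \in components G ->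
      complete_bipartite (induced G C) (side C true) (side C false).
  have /fin_all_exists[f fP] : forall C : {set T}, exists AB : {set T} * {set T},
      C \in components G -> complete_bipartite (induced G C) AB.1 AB.2.
    move=> C; have [/G_bip[A [B AB]]|_] := boolP (C \in components G).
      by exists (A, B).
    (* A dummy value, to make the choice of sides a total function. *)
    by exists (set0, set0).
  by exists (fun C b => if b then (f C).1 else (f C).2) => C /fP.
have [_ nconn minU] := GP_min.
have cov := cover_partition P_partition.
have varsW := meets_vars P_partition sideP.
have cP : #|P| = #|vars (meets side) P (components G)| by rewrite varsW.
have nc : ~~ conn (meets side) P (components G).
  by apply: contra nconn; apply: (conn_RG G_simple P_partition sideP).
have minc U0 : U0 \in P -> conn (meets side) (P :\ U0) (components G).
  move=> U0P; apply: (RG_conn G_simple P_partition sideP) (minU U0 U0P).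
  - exact: subsetDl.
  - apply/setP=> x; rewrite !inE -cov; apply/andP/bigcupP.
      case=> /bigcupP[U UP xU] xU0; exists U => //; rewrite !inE UP andbT.
      by apply: contraNneq xU0 => <-.
    case=> U; rewrite !inE => /andP[UU0 UP] xU; split.
      by apply/bigcupP; exists U.
    apply: contraNN UU0 => xU0; apply/eqP.
    case/and3P: P_partition => _ tI _.
    by rewrite -(def_pblock tI UP xU) (def_pblock tI U0P xU0).
  - by move=> x y; rewrite /= !inE => /andP[_ xU] /andP[_ yU]; rewrite xU yU.
move=> U UP; have [C [b [CW u]]] := min_disconnected_unique cP nc minc UP.
have sub := meets_unique P_partition sideP UP CW u.
exists C, (side C b), (side C (~~ b)); split=> //.
by case: b {u sub} => /=; [|apply: complete_bipartite_sym]; apply: sideP.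
Qed.
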